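(* Let $d\ge1$, $0<\underline k\le\overline k$, and let $c>0$ be a constant depending only on $(d,\overline k,\underline k)$. There is a constant $C>0$ depending only on $(d,\overline k,\underline k)$ (and $c$) such that the following holds. Let $n\ge1$, let $\Sigma_1,\dots,\Sigma_n$ be $d\times d$ symmetric matrices with $\underline kI_d\preceq\Sigma_i\preceq\overline kI_d$ for all $i$, let $\mu\in\mathbb{R}^d$, $G^*=\delta_\mu$, and let $X_1,\dots,X_n$ be independent with $X_i\sim\mathcal{N}(\mu,\Sigma_i)$. Let $\bar X=\frac1n\sum_{i=1}^nX_i$, $r=\max_i\|X_i-\bar X\|_2$ and $\kappa=\overline k/\underline k$. Let $\widehat G_n$ be any data-dependent probability measure supported on the ball $\{y\in\mathbb{R}^d:\|y-\bar X\|_2\le\kappa r\}$ such that $$\ell_n(G^* )-\ell_n(\widehat G_n)\le c\,\frac{(\log n)^{d+1}}{n}.$$ Then for all $t\ge1$, with probability at least $1-3n^{-t^2}$, $$W_2(\widehat G_n,G^* )\le C\,t^{3/2}\,\frac{(\log n)^{(d+3)/4}}{n^{1/4}} .$$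
   Context: $\delta_\mu$ is the point mass at $\mu$. $\varphi_\Sigma$ is the $\mathcal{N}(0,\Sigma)$ density on $\mathbb{R}^d$, $f_{G,\Sigma}(x)=\int\varphi_\Sigma(x-\theta)\,dG(\theta)$ for a Borel probability measure $G$ on $\mathbb{R}^d$, and $\ell_n(G)=\frac1n\sum_{i=1}^n\log f_{G,\Sigma_i}(X_i)$. $A\preceq B$ means $B-A$ is positive semidefinite. $W_2^2(G,H)=\min\mathbb{E}\|U-V\|_2^2$, the minimum being over all couplings $(U,V)$ with $U\sim G$, $V\sim H$. *)

(* Defs.v *)
From HB Require Import structures.
From mathcomp Require Import all_boot all_order all_algebra.
From mathcomp Require Import all_classical all_reals all_analysis.
From mathcomp Require Import measurable_realfun.

Set Implicit Arguments.
Unset Strict Implicit.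
Unset Printing Implicit Defensive.
Import Order.TTheory GRing.Theory Num.Theory.
Import numFieldNormedType.Exports.

Local Open Scope classical_set_scope.
Local Open Scope ring_scope.

(* Points of R^d are row vectors, and [measurable] on them is the Borel
   sigma-algebra. *)
HB.instance Definition _ (R : realType) (m n : nat) :=
  @isMeasurable.Build (sigma_display (@open 'M[R]_(m, n))) 'M[R]_(m, n)
    <<s @open 'M[R]_(m, n) >> (@sigma_algebra0 _ setT _)
    (@sigma_algebraC _ _) (@sigma_algebra_bigcup _ setT _).

Section borel_coordinates.
Context (R : realType).

Lemma measurable_coord d (i : 'I_d) :
  measurable_fun setT (fun v : 'rV[R]_d => v ord0 i).
Proof.
apply: (measurability _ (RGenOpens.measurableE R)).
move=> _ [_ [a [b ->] <-]]; rewrite setTI; apply: sub_sigma_algebra.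
by move/continuousP: (@coord_continuous R 1 d ord0 i); apply; exact: interval_open.
Qed.

Lemma borel_rV_sub d (S : set_system 'rV[R]_d) :
  sigma_algebra setT S ->
  (forall i A, measurable A -> S ((fun v : 'rV[R]_d => v ord0 i) @^-1` A)) ->
  forall U : set 'rV[R]_d, measurable U -> S U.
Proof.
move=> sS cS U; apply: (smallest_sub sS) => {}U oU.
have [S0 SC SU] := sS.
have ST : S setT by rewrite -(setD0 setT); exact: SC.
have S_setC A : S A -> S (~` A) by rewrite -setTD; exact: SC.
have S_bigcapI (F : 'I_d -> set 'rV[R]_d) (s : seq 'I_d) :
    (forall i, S (F i)) -> S (\big[setI/setT]_(i <- s) F i).
  move=> SF; elim/big_ind : _ => // A B SA SB.
  rewrite -[A `&` B]setCK; apply: (S_setC); rewrite setCI -bigcup2E.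
  by apply: SU => -[|[|n]] //=; exact: (S_setC).
pose box (p : 'rV[rat]_d * nat) : set 'rV[R]_d :=
  \big[setI/setT]_(i <- enum 'I_d)
    ((fun v : 'rV[R]_d => v ord0 i) @^-1` ball (ratr (p.1 ord0 i) : R) p.2.+1%:R^-1).
have boxP p v : box p v <->
    forall i, ball (ratr (p.1 ord0 i) : R) p.2.+1%:R^-1 (v ord0 i).
  rewrite /box -bigcap_seq; split => [H i|H i _]; last exact: H.
  by apply: (H i) => /=; rewrite mem_enum.
have Sbox p : S (box p).
  by rewrite /box; apply: S_bigcapI => i; apply: cS; apply: open_measurable; apply: ball_open; rewrite invr_gt0 ltr0n.
pose G (k : nat) : set 'rV[R]_d :=
  if unpickle k is Some p then (if `[< box p `<=` U >] then box p else set0)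
  else set0.
suff -> : U = \bigcup_k G k.
  by apply: SU => k; rewrite /G; case: unpickle => // p; case: ifPn.
apply/seteqP; split => [x Ux|x [k _]]; last first.
  by rewrite /G; case: unpickle => // p; case: ifPn => // /asboolP; apply.
move: oU; rewrite openE => /(_ _ Ux) /nbhs_ballP[e /= e0 xeU].
have [k ke] : exists k, k.+1%:R^-1 < e / 2.
  have e20 : 0 < e / 2 by rewrite divr_gt0.
  exists (Num.truncn (e / 2)^-1); rewrite invf_plt ?posrE// ?ltr0n//.
  exact: Num.Theory.truncnS_gt.
have /choice [q xq] : forall i, exists q : rat,
    ball (ratr q : R) k.+1%:R^-1 (x ord0 i).
  move=> i.
  have k0 : 0 < k.+1%:R^-1 :> R by rewrite invr_gt0 ltr0n.
  have /rat_in_itvoo [q] : x ord0 i - k.+1%:R^-1 < x ord0 i + k.+1%:R^-1.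
    by rewrite ltrBlDr -addrA ltrDl addr_gt0.
  rewrite in_itv /= => qx; exists q.
  by rewrite -ball_normE /ball_ /= ltr_distl.
pose p : 'rV[rat]_d * nat := (\row_i q i, k).
exists (pickle p) => //; rewrite /G pickleK; case: ifPn => [_|/negP[]].
  by apply/boxP => i; rewrite mxE; exact: xq.
apply/asboolP => y /boxP py; apply: xeU; split => // i j.
rewrite (ord1 i); have := py j; rewrite mxE /= => qy.
apply: le_ball (ball_triangle (ball_sym (xq j)) qy).
by rewrite (splitr e) lerD// ltW.
Qed.

Lemma measurable_fun_rV d (dT : measure_display) (T : measurableType dT)
    (f : T -> 'rV[R]_d) :
  (forall i, measurable_fun setT (fun x => f x ord0 i)) ->
  measurable_fun setT f.
Proof.
move=> mf _ Y mY; rewrite setTI.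
apply: (@borel_rV_sub d [set B | measurable (f @^-1` B)]) mY.
  split => //=.
  - by rewrite preimage_set0.
  - by move=> A mA; rewrite setTD preimage_setC; exact: measurableC.
  - by move=> F mF; rewrite preimage_bigcup; exact: bigcup_measurable.
by move=> i A mA /=; have := mf i measurableT A mA; rewrite setTI.
Qed.

Definition rV_cons d (p : R * 'rV[R]_d) : 'rV[R]_(1 + d) :=
  row_mx (p.1)%:M p.2.

Lemma measurable_rV_cons d : measurable_fun setT (@rV_cons d).
Proof.
apply: measurable_fun_rV => i.
case: (split_ordP i) => j -> /=.
  rewrite (_ : (fun _ => _) = fst) ?measurable_fst//.
  by apply/funext => p; rewrite row_mxEl (ord1 j) mxE eqxx mulr1n.
rewrite (_ : (fun _ => _) = (fun v : 'rV[R]_d => v ord0 j) \o snd).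
  by apply: measurableT_comp (measurable_coord j) _; exact: measurable_snd.
by apply/funext => p; rewrite row_mxEr.
Qed.

End borel_coordinates.


Section lebesgue.
Context (R : realType).

Definition lebesgue_cons d (mu : {measure set 'rV[R]_d -> \bar R}) :=
  pushforward (lebesgue_measure \x^ mu)%E (@rV_cons R d).

HB.instance Definition _ d (mu : {measure set 'rV[R]_d -> \bar R}) :=
  Measure.copy (lebesgue_cons mu)
    (measure_function_pushforward__canonical__measure_function_Measure
      (lebesgue_measure \x^ mu)%E (@measurable_rV_cons R d)).

(* Lebesgue measure on R^d: the d-fold product of Lebesgue measure on R, carried
   over to row vectors one coordinate at a time. *)
Fixpoint lebesgue_rV (d : nat) : {measure set 'rV[R]_d -> \bar R} :=
  match d with
  | 0 => \d_(0 : 'rV[R]_0)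
  | d'.+1 => lebesgue_cons (lebesgue_rV d')
  end.

End lebesgue.

Section gaussian.
Context (R : realType) (d : nat).
Implicit Types (Sigma : 'M[R]_d) (x mu : 'rV[R]_d).

(* The norm [`|x|] of the library on matrices is the sup norm. *)
Definition norm2 x : R := Num.sqrt (\sum_(i < d) x ord0 i ^+ 2).

Definition psd (A : 'M[R]_d) : Prop :=
  A^T = A /\ forall v : 'rV[R]_d, 0 <= (v *m A *m v^T) ord0 ord0.

Definition loewner_le (A B : 'M[R]_d) : Prop := psd (B - A).

Definition gauss_pdf Sigma x : R :=
  expR (- (x *m invmx Sigma *m x^T) ord0 ord0 / 2)
    / Num.sqrt ((2 * pi) ^+ d * \det Sigma).

Definition has_normal_law (dT : measure_display) (T : measurableType dT)
    (P : probability T R) (X : T -> 'rV[R]_d) mu Sigma : Prop :=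
  measurable_fun setT X /\
  forall A : set 'rV[R]_d, measurable A ->
    P (X @^-1` A) = (\int[lebesgue_rV R d]_(x in A) (gauss_pdf Sigma (x - mu))%:E)%E.

Definition gauss_mix (G : probability 'rV[R]_d R) Sigma x : R :=
  \int[G]_theta gauss_pdf Sigma (x - theta).

Definition loglik n (Sigma : 'I_n -> 'M[R]_d) (x : 'I_n -> 'rV[R]_d)
    (G : probability 'rV[R]_d R) : R :=
  n%:R^-1 * \sum_(i < n) ln (gauss_mix G (Sigma i) (x i)).

Definition sample_mean n (x : 'I_n -> 'rV[R]_d) : 'rV[R]_d :=
  n%:R^-1 *: \sum_(i < n) x i.

Definition sample_radius n (x : 'I_n -> 'rV[R]_d) : R :=
  \big[Num.max/0]_(i < n) norm2 (x i - sample_mean x).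

Definition is_coupling (G H : probability 'rV[R]_d R)
    (g : probability ('rV[R]_d * 'rV[R]_d)%type R) : Prop :=
  forall A : set 'rV[R]_d, measurable A ->
    g (fst @^-1` A) = G A /\ g (snd @^-1` A) = H A.

(* The Kantorovich minimum, written as an infimum in [\bar R]. *)
Definition W2 (G H : probability 'rV[R]_d R) : \bar R :=
  sqrte (ereal_inf [set (\int[g]_p (norm2 (p.1 - p.2) ^+ 2)%:E)%E
                   | g in is_coupling G H]).

End gaussian.

Definition mutually_independent (R : realType) (d n : nat)
    (dT : measure_display) (T : measurableType dT) (P : probability T R)
    (X : 'I_n -> T -> 'rV[R]_d) : Prop :=
  forall (J : {set 'I_n}) (A : 'I_n -> set 'rV[R]_d),
    (forall i, measurable (A i)) ->
    P (\bigcap_(i in [set` J]) (X i @^-1` A i)) =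
      (\prod_(i in J) P (X i @^-1` A i))%E.

(* [E] need not be measurable: it is required to contain a measurable event of
   probability at least [p]. *)
Definition with_prob_ge (R : realType) (dT : measure_display)
    (T : measurableType dT) (P : probability T R) (p : R) (E : set T) : Prop :=
  exists F : set T, [/\ measurable F, F `<=` E & (p%:E <= P F)%E].

(* Main.v *)
Require Import Defs.
From mathcomp Require Import all_boot all_order all_algebra.
From mathcomp Require Import all_classical all_reals all_analysis.
From mathcomp Require Import measurable_realfun.
From mathcomp Require Import ring lra.
Import Order.TTheory GRing.Theory Num.Theory.
Import numFieldNormedType.Exports.
Local Open Scope classical_set_scope.
Local Open Scope ring_scope.

(* Write L_i(G) for the likelihood ratio of the mixture G against the point mass
   at mu, evaluated at X_i. For a fixed G, testing with the bounded function
   exp(-3/2 |.|^2), in the Mahalanobis norm, gives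
   E sqrt(L_i(G)) <= 1 - h tau(G)^2, where tau(G) is the G-mean of
   min(|theta - mu|^2, 1); by independence and Markov's inequality the product of
   the sqrt(L_i(G)) is then small unless tau(G)^2 is of order
   t^2 (log n)^(d+1) / n. To make this uniform in G, note that for
   |X_i - mu| = O(sqrt(log n)) the atoms of G beyond O(sqrt(log n)) contribute
   O(n^-2), while on the remaining ball the likelihood ratio is, up to O(n^-2), a
   polynomial in theta of degree O(log n). Hence L_i(G) is determined up to O(n^-2)
   by (C log n)^d rounded moments of G, and one representative per cell of moments
   gives a net of log-cardinality O((log n)^(d+1)). The observations with larger
   |X_i - mu| contribute O(t^2 log n) in total, and they also bound the sample
   radius by O(t sqrt(log n)), so that W_2^2 <= O(t^2 log n) tau(G). *)

(** * Lebesgue measure under affine maps *)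

(** [Ghat] is an arbitrary function of the data, so the good event must be fixed before any
    estimator is named and must serve all G at once. The square root has a second role: an additive
    error of order n^-2 in a likelihood ratio costs only O(1/n) in its square root, so over n
    observations it multiplies the expected product by a constant; hence the accuracy n^-2 asked of
    the moments. Moments do not determine tau, so the representatives of the cells are picked among
    mixtures that already have large tau. No Gaussian integral and no determinant is computed: the
    law of X_i supplies the total mass of its own density, and the rest is completing the square and
    substituting x -> s x + b. The exponent 3/2 of the test function, and the exponent 3/8 used for
    tails, are those for which s comes out as 2 and 1/2. Finally W_2^4 <= O(t^4 (log n)^2) tau^2 and
    tau^2 <= O(t^2 (log n)^(d+1) / n) give the exponents 3/2, (d+3)/4 and 1/4 of the statement. *)

Section affine.
Context {R : realType}.

Lemma measurable_fun_affine {d} (s : R) (b : 'rV[R]_d) :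
  measurable_fun setT (fun v : 'rV[R]_d => s *: v + b).
Proof.
apply: measurable_fun_rV => i.
rewrite (_ : (fun _ => _) = (fun v : 'rV[R]_d => s * v ord0 i + b ord0 i)); last first.
  by apply/funext => v; rewrite !mxE.
apply: measurable_funD => //; apply: measurable_funM => //.
exact: measurable_coord.
Qed.

Lemma measurable_fun_affine1 (s b : R) :
  measurable_fun setT (fun x : R => s * x + b).
Proof. by apply: measurable_funD => //; apply: measurable_funM. Qed.

(** The image of Lebesgue measure, multiplied by s, agrees with Lebesgue measure on half-open
    intervals, which determine it. *)
Lemma lebesgue_measure_affine (s b : R) (A : set (measurableTypeR R)) :
  0 < s -> measurable A ->
  lebesgue_measure ((fun x => s * x + b) @^-1` A)
  = (s^-1%:E * lebesgue_measure A)%E.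
Proof.
move=> s0 mA.
have mphi : measurable_fun setT
    ((fun x => s * x + b) : measurableTypeR R -> measurableTypeR R).
  exact: measurable_fun_affine1.
pose m1 := mscale (NngNum (ltW s0))
  (measure_function_pushforward__canonical__measure_function_Measure
     (@lebesgue_measure R) mphi).
have -> : lebesgue_measure A = m1 A.
  apply: lebesgue_measure_unique => // _ [[u v]] _ <-.
  rewrite /m1 /= /mscale /= /pushforward /=.
  have -> : (fun x : measurableTypeR R => s * x + b) @^-1` `]u, v]%classic
          = `](u - b) / s, (v - b) / s]%classic.
    apply/seteqP; split => x /=; rewrite !in_itv/=.
      by rewrite ltr_pdivrMr// ler_pdivlMr// ltrBlDr lerBrDr (mulrC x).
    by rewrite ltr_pdivrMr// ler_pdivlMr// ltrBlDr lerBrDr (mulrC x).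
  rewrite !lebesgue_measure_itv /= !lte_fin ltr_pM2r ?invr_gt0//.
  rewrite ltrD2r; case: ifPn; rewrite ?mule0// => _.
  rewrite -!EFinB -EFinM; congr EFin.
  by rewrite -mulrBl mulrCA mulfV ?gt_eqF// mulr1; ring.
by rewrite /m1 /= /mscale /= muleA -EFinM mulVf ?gt_eqF// mul1e.
Qed.

(** The induction follows the construction of [lebesgue_rV]: each section of the preimage is a
    one-dimensional affine preimage, which gives one factor s^-1, and the index of the section is
    itself moved by an affine map in dimension d, where the induction hypothesis gives s^-d. *)
Lemma lebesgue_rV_affine {d} (s : R) (b : 'rV[R]_d) (A : set 'rV[R]_d) :
  0 < s -> measurable A ->
  lebesgue_rV R d ((fun x => s *: x + b) @^-1` A)
  = ((s^-1 ^+ d)%:E * lebesgue_rV R d A)%E.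
Proof.
move=> s0; elim: d b A => [b A mA|d IH b A mA].
  rewrite expr0 mul1e; congr (lebesgue_rV R 0 _).
  by apply/seteqP; split => x /=; rewrite [s *: x + b]thinmx0 (thinmx0 x).
have mB : measurable (@rV_cons R d @^-1` A).
  by rewrite -[X in measurable X]setTI; exact: measurable_rV_cons.
rewrite /= /lebesgue_cons /pushforward /product_measure2 /=.
set B := (@rV_cons R d @^-1` A) in mB *.
pose b0 := lsubmx (b : 'rV_(1 + d)) ord0 ord0.
pose b' := rsubmx (b : 'rV_(1 + d)).
have secE y : ysection (@rV_cons R d @^-1` ((fun x => s *: x + b) @^-1` A)) y =
    (fun x => s * x + b0) @^-1` (ysection B (s *: y + b')).
  apply/seteqP; split => x /=; rewrite !/ysection /= !inE /= /B /=;
  suff -> : s *: rV_cons (x, y) + b = rV_cons (s * x + b0, s *: y + b') by [];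
  rewrite /rV_cons /= scale_row_mx -[X in _ + X](@hsubmxK _ 1 1 d b) add_row_mx;
  congr row_mx; rewrite [lsubmx _]mx11_scalar -/b0 raddfD /= scale_scalar_mx //.
rewrite (eq_integral (fun y : 'rV[R]_d =>
    (s^-1)%:E * lebesgue_measure (ysection B (s *: y + b')%R))%E); last first.
  move=> y _; rewrite secE lebesgue_measure_affine//.
  exact: measurable_ysection.
have mF : measurable_fun setT (fun y => lebesgue_measure (ysection B y)).
  exact: measurable_fun_ysection.
rewrite ge0_integralZl//; last 2 first.
- apply: (measurableT_comp mF); exact: measurable_fun_affine.
- by rewrite lee_fin invr_ge0 ltW.
rewrite exprS EFinM -muleA; congr (_ * _)%E.
rewrite -(ge0_integral_pushforward (measurable_fun_affine s b') (lebesgue_rV R d)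
           (f := fun y : 'rV[R]_d => lebesgue_measure (ysection B y)) measurableT)//.
have sd0 : 0 <= s^-1 ^+ d by rewrite exprn_ge0// invr_ge0 ltW.
rewrite -(ge0_integral_mscale (lebesgue_rV R d) measurableT (NngNum sd0) mF)//.
apply: eq_measure_integral; first exact: measurable_fun_affine.
move=> mphi S mS _.
exact: (IH b' S mS).
Qed.

Lemma ge0_integral_lebesgue_rV_affine {d} (s : R) (b : 'rV[R]_d)
    (f : 'rV[R]_d -> \bar R) :
  0 < s -> measurable_fun setT f -> (forall x, (0 <= f x)%E) ->
  (\int[lebesgue_rV R d]_x f (s *: x + b)%R
   = (s^-1 ^+ d)%:E * \int[lebesgue_rV R d]_x f x)%E.
Proof.
move=> s0 mf f0.
rewrite -(ge0_integral_pushforward (measurable_fun_affine s b) (lebesgue_rV R d) (f := f) measurableT)//.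
have sd0 : 0 <= s^-1 ^+ d by rewrite exprn_ge0// invr_ge0 ltW.
rewrite -(ge0_integral_mscale (lebesgue_rV R d) measurableT (NngNum sd0) mf)//.
apply: eq_measure_integral; first exact: measurable_fun_affine.
move=> mphi S mS _.
exact: (lebesgue_rV_affine s b S s0 mS).
Qed.
End affine.

(** * Equality of weighted integrals from equality on measurable sets *)

Section monotone_class.
Context {R : realType} {d1 d2 d3 : measure_display} {T1 : measurableType d1}
  {T2 : measurableType d2} {U : measurableType d3}
  (m1 : {measure set T1 -> \bar R}) (m2 : {measure set T2 -> \bar R}).
Local Open Scope ereal_scope.
Import HBNNSimple.

Let nnsfun_weight d (T : measurableType d) (m : {measure set T -> \bar R})
    (X : T -> U) (w : T -> R) (f : {nnsfun U >-> R}) :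
  measurable_fun setT X -> measurable_fun setT w -> (forall x, (0 <= w x)%R) ->
  \int[m]_x ((f (X x))%:E * (w x)%:E)
  = \sum_(r \in range f) r%:E * \int[m]_(x in X @^-1` (f @^-1` [set r])) (w x)%:E.
Proof.
move=> mX mw w0.
have mXf r : measurable (X @^-1` (f @^-1` [set r])).
  by rewrite -[X in measurable X]setTI; apply: mX.
transitivity (\int[m]_x (\sum_(r \in range f)
    (r%:E * ((\1_(X @^-1` (f @^-1` [set r])) x)%:E * (w x)%:E)))).
  apply: eq_integral => x _; rewrite {1}(fimfunE f) -fsumEFin//.
  rewrite ge0_mule_fsuml//; last first.
    by move=> r; rewrite EFinM nnfun_muleindic_ge0.
  by apply: eq_fsbigr => r _; rewrite EFinM -muleA.
rewrite ge0_integral_fsum//; last 2 first.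
- move=> r; apply: measurable_funeM; apply: emeasurable_funM; exact/measurable_EFinP.
- move=> r x _; rewrite muleA mule_ge0//.
    exact: (nnfun_muleindic_ge0 f r (X x)).
  by rewrite lee_fin.
(* The level set of a negative r is empty, so r has to be pulled out of the integral only when it is
   nonnegative. *)
apply: eq_fsbigr => r _; have [r0|r0] := ltP r 0%R.
  rewrite preimage_nnfun0// preimage_set0 integral_set0 mule0.
  by rewrite integral0_eq// => x _; rewrite indic0 mul0e mule0.
rewrite ge0_integralZl//; last 2 first.
- apply: emeasurable_funM; exact/measurable_EFinP.
- by move=> x _; rewrite mule_ge0// lee_fin.
congr (_ * _); rewrite [RHS]integral_mkcond; apply: eq_integral => x _.
rewrite patchE indicE; case: ifPn => _; first by rewrite mul1e.
by rewrite mul0e.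
Qed.

(** Simple functions, then monotone convergence. Having its own space, map and weight on each side,
    it serves both to pass from a law to its density and to split off one independent coordinate. *)
Lemma eq_weighted_integral (X1 : T1 -> U) (X2 : T2 -> U)
    (w1 : T1 -> R) (w2 : T2 -> R) (f : U -> \bar R) :
  measurable_fun setT X1 -> measurable_fun setT X2 ->
  measurable_fun setT w1 -> measurable_fun setT w2 ->
  (forall x, (0 <= w1 x)%R) -> (forall x, (0 <= w2 x)%R) ->
  measurable_fun setT f -> (forall u, 0 <= f u) ->
  (forall A, measurable A ->
    \int[m1]_(x in X1 @^-1` A) (w1 x)%:E = \int[m2]_(x in X2 @^-1` A) (w2 x)%:E) ->
  \int[m1]_x (f (X1 x) * (w1 x)%:E) = \int[m2]_x (f (X2 x) * (w2 x)%:E).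
Proof.
move=> mX1 mX2 mw1 mw2 w10 w20 mf f0 H.
pose f_ := nnsfun_approx measurableT mf.
have limE d (T : measurableType d) (m : {measure set T -> \bar R}) (X : T -> U)
    (w : T -> R) : measurable_fun setT X -> measurable_fun setT w ->
    (forall x, (0 <= w x)%R) ->
    \int[m]_x (f (X x) * (w x)%:E) =
    limn (fun n => \int[m]_x ((f_ n (X x))%:E * (w x)%:E)).
  move=> mX mw w0; rewrite -monotone_convergence//.
  - apply: eq_integral => x _; apply/esym/cvg_lim => //.
    have fcvg : EFin \o f_ ^~ (X x) @ \oo --> f (X x).
      by apply: cvg_nnsfun_approx.
    exact: cvgeZr.
  - move=> n; apply: emeasurable_funM; apply/measurable_EFinP => //.
    exact: measurableT_comp.
  - by move=> n x _; rewrite mule_ge0// lee_fin.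
  - move=> x _ a b ab; apply: lee_wpmul2r; rewrite lee_fin//.
    exact/lefP/nd_nnsfun_approx.
rewrite !limE//; congr (limn _); apply/funext => n.
rewrite !nnsfun_weight//.
by apply: eq_fsbigr => r _; rewrite H.
Qed.
End monotone_class.

(** * Quadratic forms *)

Section quadratic_form.
Context {R : realType} {d : nat}.
Implicit Types (A S : 'M[R]_d) (x y : 'rV[R]_d).

Definition bform A x y : R := (x *m A *m y^T) ord0 ord0.

Lemma bformDl A x y z : bform A (x + y) z = bform A x z + bform A y z.
Proof. by rewrite /bform !mulmxDl mxE. Qed.

Lemma bformDr A x y z : bform A x (y + z) = bform A x y + bform A x z.
Proof. by rewrite /bform linearD /= mulmxDr mxE. Qed.

Lemma bformZl A a x y : bform A (a *: x) y = a * bform A x y.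
Proof. by rewrite /bform -!scalemxAl mxE. Qed.

Lemma bformZr A a x y : bform A x (a *: y) = a * bform A x y.
Proof. by rewrite /bform linearZ /= -scalemxAr mxE. Qed.

Lemma bformNl A x y : bform A (- x) y = - bform A x y.
Proof. by rewrite -scaleN1r bformZl mulN1r. Qed.

Lemma bformNr A x y : bform A x (- y) = - bform A x y.
Proof. by rewrite -scaleN1r bformZr mulN1r. Qed.

Lemma bformB A B x y : bform (A - B) x y = bform A x y - bform B x y.
Proof. by rewrite /bform mulmxBr mulmxBl !mxE. Qed.

Lemma bformC A x y : A^T = A -> bform A x y = bform A y x.
Proof.
move=> AT; rewrite /bform -[in LHS](trmxK (x *m A *m y^T)) mxE.
by rewrite !trmx_mul trmxK AT mulmxA.
Qed.

Lemma bformE A x y : bform A x y = \sum_i \sum_j A i j * x ord0 i * y ord0 j.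
Proof.
rewrite /bform mxE exchange_big /=; apply: eq_bigr => j _.
rewrite !mxE mulr_suml; apply: eq_bigr => i _; by rewrite (mulrC (A i j)).
Qed.

Lemma norm2_ge0 x : 0 <= norm2 x. Proof. exact: sqrtr_ge0. Qed.

Lemma norm2_sqr x : norm2 x ^+ 2 = \sum_i x ord0 i ^+ 2.
Proof. by rewrite sqr_sqrtr// sumr_ge0// => i _; exact: sqr_ge0. Qed.

Lemma bform1 x : bform 1%:M x x = norm2 x ^+ 2.
Proof.
rewrite norm2_sqr /bform mulmx1 mxE; apply: eq_bigr => i _.
by rewrite mxE expr2.
Qed.

Lemma bform_scalar a x : bform a%:M x x = a * norm2 x ^+ 2.
Proof. by rewrite -bform1 /bform mul_mx_scalar mulmx1 -scalemxAl mxE. Qed.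

Lemma norm2_le_sqrt x a : 0 <= a -> norm2 x ^+ 2 <= a ^+ 2 -> norm2 x <= a.
Proof. by move=> a0; rewrite ler_sqr ?nnegrE ?norm2_ge0. Qed.

Lemma bform1_le x y : bform 1%:M x y <= norm2 x * norm2 y.
Proof.
(* The expansion of |x - s y|^2. *)
have sq s : 0 <= norm2 x ^+ 2 - 2 * s * bform 1%:M x y + s ^+ 2 * norm2 y ^+ 2.
  have := bform1 (x - s *: y).
  rewrite !(bformDl, bformDr, bformNl, bformNr, bformZl, bformZr) !bform1.
  rewrite (bformC _ y x) ?tr_scalar_mx// => E.
  have := sqr_ge0 (norm2 (x - s *: y)); rewrite -E; nra.
have [b0|b0] := leP (bform 1%:M x y) 0.
  by rewrite (le_trans b0)// mulr_ge0 ?norm2_ge0.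
have [y0|y0] := eqVneq (norm2 y) 0.
  (* With |y| = 0 the quadratic is affine in s, and this s gives it the value -1, which rules out a
     positive inner product. *)
  have := sq ((norm2 x ^+ 2 + 1) / (2 * bform 1%:M x y)).
  rewrite y0 expr0n/= mulr0 addr0.
  have -> : 2 * ((norm2 x ^+ 2 + 1) / (2 * bform 1%:M x y)) * bform 1%:M x y
          = norm2 x ^+ 2 + 1 by field; rewrite gt_eqF.
  lra.
have yp : 0 < norm2 y by rewrite lt_neqAle eq_sym y0 norm2_ge0.
rewrite -ler_sqr ?nnegrE ?mulr_ge0 ?norm2_ge0 ?(ltW b0)//.
have := sq (bform 1%:M x y / norm2 y ^+ 2).
set b := bform _ _ _; set u := norm2 x; set v := norm2 y in yp *.
have -> : u ^+ 2 - 2 * (b / v ^+ 2) * b + (b / v ^+ 2) ^+ 2 * v ^+ 2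
   = ((u * v) ^+ 2 - b ^+ 2) / v ^+ 2.
  by field; rewrite gt_eqF.
by rewrite pmulr_lge0 ?invr_gt0 ?exprn_gt0// subr_ge0.
Qed.

Lemma norm2D x y : norm2 (x + y) <= norm2 x + norm2 y.
Proof.
apply: norm2_le_sqrt; first by rewrite addr_ge0 ?norm2_ge0.
rewrite -bform1 !(bformDl, bformDr) !bform1 (bformC _ y x) ?tr_scalar_mx//.
have := bform1_le x y; rewrite sqrrD; lra.
Qed.

Lemma norm2Z a x : norm2 (a *: x) = `|a| * norm2 x.
Proof.
apply/eqP; rewrite -(@eqrXn2 _ 2)// ?mulr_ge0 ?norm2_ge0//.
by rewrite -bform1 bformZl bformZr bform1 exprMn real_normK ?num_real// mulrA.
Qed.

Lemma norm2N x : norm2 (- x) = norm2 x.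
Proof. by rewrite -scaleN1r norm2Z normrN1 mul1r. Qed.

Lemma norm2B x y : norm2 (x - y) <= norm2 x + norm2 y.
Proof. by rewrite -(norm2N y) norm2D. Qed.

Lemma norm20 : norm2 (0 : 'rV[R]_d) = 0.
Proof. by rewrite -(scale0r 0) norm2Z normr0 mul0r. Qed.

Lemma norm2_eq0 x : norm2 x = 0 -> x = 0.
Proof.
move=> x0; apply/rowP => i; rewrite mxE; apply/eqP; rewrite -sqrf_eq0.
have /eqP := norm2_sqr x; rewrite x0 expr0n/= eq_sym psumr_eq0.
  by move=> /allP /(_ i); rewrite mem_index_enum => /(_ isT).
by move=> j _; exact: sqr_ge0.
Qed.

Lemma coord_le_norm2 x i : `|x ord0 i| <= norm2 x.
Proof.
rewrite -ler_sqr ?nnegrE ?norm2_ge0// norm2_sqr real_normK ?num_real//.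
by rewrite (bigD1 i)//= lerDl sumr_ge0// => j _; exact: sqr_ge0.
Qed.

Section inverse.
Variables (S : 'M[R]_d) (a b : R).
Hypotheses (a0 : 0 < a) (ST : S^T = S)
  (aS : loewner_le a%:M S) (Sb : loewner_le S b%:M).

Lemma loewner_bform_ge x : a * norm2 x ^+ 2 <= bform S x x.
Proof.
by have := aS.2 x; rewrite -[X in 0 <= X -> _]/(bform _ x x) bformB bform_scalar subr_ge0.
Qed.

Lemma loewner_bform_le x : bform S x x <= b * norm2 x ^+ 2.
Proof.
by have := Sb.2 x; rewrite -[X in 0 <= X -> _]/(bform _ x x) bformB bform_scalar subr_ge0.
Qed.

Lemma loewner_unitmx : S \in unitmx.
Proof.
rewrite -row_free_unit -kermx_eq0; apply/eqP/row_matrixP => i.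
rewrite row0; apply: norm2_eq0; apply/eqP; rewrite -sqrf_eq0.
have kS : row i (kermx S) *m S = 0 by rewrite -row_mul mulmx_ker row0.
have := loewner_bform_ge (row i (kermx S)).
by rewrite /bform kS mul0mx mxE pmulr_rle0// => h; rewrite eq_le h sqr_ge0.
Qed.

Lemma invmx_sym : (invmx S)^T = invmx S.
Proof. by rewrite trmx_inv ST. Qed.

Let dualE x : bform (invmx S) x x = bform 1%:M x (x *m invmx S).
Proof. by rewrite bformC ?tr_scalar_mx// /bform mulmx1. Qed.

Let dualE' x : bform (invmx S) x x = bform S (x *m invmx S) (x *m invmx S).
Proof.
rewrite /bform mulmxKV ?loewner_unitmx// trmx_mul invmx_sym mulmxA.
by [].
Qed.

(** With y = x S^-1 and q the form of S^-1 at x, expand |x - a y|^2 >= 0 and use a |y|^2 <= q, since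
    q is also the form of S at y. This avoids diagonalising S. *)
Lemma bform_invmx_le x : bform (invmx S) x x <= norm2 x ^+ 2 / a.
Proof.
set y := x *m invmx S.
have := sqr_ge0 (norm2 (x - a *: y)).
rewrite -(bform1 (x - a *: y)) !(bformDl, bformDr, bformNl, bformNr, bformZl, bformZr).
rewrite (bformC _ y x) ?tr_scalar_mx// !bform1 -dualE.
have := loewner_bform_ge y; rewrite -dualE' => yq.
have := ler_wpM2l (ltW a0) yq.
rewrite ler_pdivlMr//; lra.
Qed.

(** Dually, the form of S is nonnegative at y - x / b, and its value at x is at most b |x|^2. *)
Lemma bform_invmx_ge x : 0 < b -> norm2 x ^+ 2 / b <= bform (invmx S) x x.
Proof.
move=> b0; set y := x *m invmx S.
have SE : bform S y x = norm2 x ^+ 2.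
  by rewrite /bform mulmxKV ?loewner_unitmx// -bform1 /bform mulmx1.
have : 0 <= bform S (y - b^-1 *: x) (y - b^-1 *: x).
  apply: le_trans (loewner_bform_ge _); by rewrite mulr_ge0 ?sqr_ge0// ltW.
rewrite !(bformDl, bformDr, bformNl, bformNr, bformZl, bformZr).
rewrite (bformC _ x y) // SE -dualE'.
have := loewner_bform_le x; set q := bform S x x; set u := norm2 x ^+ 2.
set r := bform _ _ _ => qu.
have : b^-1 * (b^-1 * q) <= b^-1 * u.
  by rewrite ler_pM2l ?invr_gt0// mulrC ler_pdivrMr// mulrC.
rewrite [u / b]mulrC; lra.
Qed.
End inverse.
End quadratic_form.

(** * Gaussian expectations *)

Section gaussian_expectations.
Context {R : realType} {d : nat}.
Implicit Types (S : 'M[R]_d) (x y mu eta : 'rV[R]_d).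

Definition mahal S y : R := bform (invmx S) y y.

(** The ratio at y of the densities of N(eta, S) and N(0, S). As a single exponential it is visibly
    positive and involves no normalising factor. *)
Definition lik_ratio S y eta : R :=
  expR (mahal S y / 2 - mahal S (y - eta) / 2).

Lemma gauss_pdfE S x :
  gauss_pdf S x = expR (- mahal S x / 2) / Num.sqrt ((2 * pi) ^+ d * \det S).
Proof. by []. Qed.

Lemma gauss_pdf_ge0 S x : 0 <= gauss_pdf S x.
Proof. by rewrite gauss_pdfE divr_ge0// ?expR_ge0// sqrtr_ge0. Qed.

Lemma lik_ratioM S y eta :
  lik_ratio S y eta * gauss_pdf S y = gauss_pdf S (y - eta).
Proof.
by rewrite /lik_ratio !gauss_pdfE mulrA -expRD; congr (expR _ / _); ring.
Qed.

Section measurability.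
Context {dT : measure_display} {T : measurableType dT}.

Lemma measurable_fun_coord (f : T -> 'rV[R]_d) :
  measurable_fun setT f -> forall i, measurable_fun setT (fun t => f t ord0 i).
Proof. by move=> mf i; apply: (measurableT_comp (measurable_coord i) mf). Qed.

Lemma measurable_funB_rV (f g : T -> 'rV[R]_d) :
  measurable_fun setT f -> measurable_fun setT g ->
  measurable_fun setT (fun t => f t - g t).
Proof.
move=> mf mg; apply: measurable_fun_rV => i.
under eq_fun do rewrite !mxE.
by apply: measurable_funB; exact: measurable_fun_coord.
Qed.

Lemma measurable_bform (A : 'M[R]_d) (f g : T -> 'rV[R]_d) :
  measurable_fun setT f -> measurable_fun setT g ->
  measurable_fun setT (fun t => bform A (f t) (g t)).
Proof.
move=> mf mg; under eq_fun do rewrite bformE.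
apply: measurable_sum => i; apply: measurable_sum => j.
apply: measurable_funM; last exact: measurable_fun_coord.
by apply: measurable_funM => //; exact: measurable_fun_coord.
Qed.

Lemma measurable_mahal S (f : T -> 'rV[R]_d) :
  measurable_fun setT f -> measurable_fun setT (fun t => mahal S (f t)).
Proof. by move=> mf; exact: measurable_bform. Qed.

Lemma measurable_gauss_pdf S (f : T -> 'rV[R]_d) :
  measurable_fun setT f -> measurable_fun setT (fun t => gauss_pdf S (f t)).
Proof.
move=> mf; under eq_fun do rewrite gauss_pdfE.
apply: measurable_funM => //; apply: (measurableT_comp (@measurable_expR R)) => //.
apply: measurable_funM => //; apply: measurableT_comp => //.
exact: measurable_mahal.
Qed.

Lemma measurable_lik_ratio S (f g : T -> 'rV[R]_d) :
  measurable_fun setT f -> measurable_fun setT g ->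
  measurable_fun setT (fun t => lik_ratio S (f t) (g t)).
Proof.
move=> mf mg; rewrite /lik_ratio; apply: (measurableT_comp (@measurable_expR R)) => //.
apply: measurable_funB; apply: measurable_funM => //; apply: measurable_mahal => //.
exact: measurable_funB_rV.
Qed.

Lemma measurable_norm2 (f : T -> 'rV[R]_d) :
  measurable_fun setT f -> measurable_fun setT (fun t => norm2 (f t)).
Proof.
move=> mf; rewrite /norm2.
apply: (measurableT_comp (continuous_measurable_fun (@sqrt_continuous R))) => //.
apply: measurable_sum => i; apply: measurable_funX.
exact: measurable_fun_coord.
Qed.
End measurability.

Section law.
Context {dT : measure_display} {T : measurableType dT} (P : probability T R)
  (X : T -> 'rV[R]_d) (mu : 'rV[R]_d) (S : 'M[R]_d).
Hypothesis HX : has_normal_law P X mu S.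

Lemma expectation_normal (f : 'rV[R]_d -> R) :
  measurable_fun setT f -> (forall x, 0 <= f x) ->
  (\int[P]_w (f (X w))%:E
   = \int[lebesgue_rV R d]_x (f x * gauss_pdf S (x - mu))%:E)%E.
Proof.
move=> mf f0.
have := @eq_weighted_integral R _ _ _ T _ _ P (lebesgue_rV R d) X id
  (cst 1) (fun x => gauss_pdf S (x - mu)) (EFin \o f).
move=> H; transitivity (\int[P]_w ((EFin \o f) (X w) * (cst 1 w)%:E))%E.
  by apply: eq_integral => w _; rewrite mule1.
rewrite H//.
- exact: HX.1.
- apply: measurable_gauss_pdf; exact: measurable_funB_rV.
- by move=> x; exact: gauss_pdf_ge0.
- exact/measurable_EFinP.
- move=> A mA; rewrite -HX.2//.
  transitivity (\int[P]_(x in X @^-1` A) cst 1 x)%E => //.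
  rewrite integral_cst ?mul1e//.
  by rewrite -[X in measurable X]setTI; apply: HX.1.
Qed.

(** [has_normal_law] on the whole space says that the density has mass 1. A test function that turns
    the density into K times its copy at s y + b therefore has expectation K s^-d, by the affine
    change of variables. *)
Lemma expectation_normal_affine (f : 'rV[R]_d -> R) (K s : R) (b : 'rV[R]_d) :
  measurable_fun setT f -> (forall x, 0 <= f x) -> 0 <= K -> 0 < s ->
  (forall y, f y * gauss_pdf S y = K * gauss_pdf S (s *: y + b)) ->
  (\int[P]_w (f (X w - mu))%:E = (K * s^-1 ^+ d)%:E)%E.
Proof.
move=> mf f0 K0 s0 H.
have mpdf : measurable_fun setT (EFin \o @gauss_pdf R d S).
  by apply/measurable_EFinP; exact: measurable_gauss_pdf.
have pdf1 : (\int[lebesgue_rV R d]_x (gauss_pdf S x)%:E = 1)%E.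
  have := HX.2 setT measurableT.
  rewrite preimage_setT probability_setT => ->.
  have := ge0_integral_lebesgue_rV_affine 1 (- mu)
            (EFin \o @gauss_pdf R d S) ltr01 mpdf.
  rewrite invr1 expr1n mul1e => <-; last by move=> x; rewrite lee_fin gauss_pdf_ge0.
  by apply: eq_integral => x _; rewrite scale1r.
rewrite (expectation_normal (fun x => f (x - mu))); first last.
- by [].
- by apply: (measurableT_comp mf); exact: measurable_funB_rV.
pose g (x : 'rV[R]_d) := (EFin \o gauss_pdf S) (s *: x + (b - s *: mu)).
have mg : measurable_fun setT g.
  by apply: (measurableT_comp mpdf); exact: measurable_fun_affine.
have g0 x : setT x -> (0 <= g x)%E by rewrite lee_fin gauss_pdf_ge0.
transitivity (\int[lebesgue_rV R d]_x (K%:E * g x))%E.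
  apply: eq_integral => x _; rewrite H EFinM; congr (_ * (gauss_pdf _ _)%:E)%E.
  by rewrite scalerBr addrAC addrA.
rewrite (ge0_integralZl_EFin (lebesgue_rV R d) measurableT g0 mg K0) /g.
rewrite ge0_integral_lebesgue_rV_affine//; last first.
  by move=> x; rewrite lee_fin gauss_pdf_ge0.
by rewrite pdf1 mule1 EFinM.
Qed.

Lemma expectation_lik_ratio eta :
  (\int[P]_w (lik_ratio S (X w - mu) eta)%:E = 1)%E.
Proof.
rewrite (expectation_normal_affine (lik_ratio S ^~ eta) 1 1 (- eta))//.
- by rewrite mul1r invr1 expr1n.
- exact: measurable_lik_ratio.
- by move=> x; exact: expR_ge0.
- by move=> y; rewrite lik_ratioM mul1r scale1r.
Qed.

(** Since 3/8 - 1/2 = -1/8, the product with the density is the density at y / 2. *)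
Lemma expectation_expR_mahal :
  (\int[P]_w (expR (3 / 8 * mahal S (X w - mu)))%:E = (2 ^+ d)%:E)%E.
Proof.
rewrite (expectation_normal_affine (fun y => expR (3 / 8 * mahal S y)) 1 2^-1 0)//.
- by rewrite mul1r invrK.
- apply: (measurableT_comp (@measurable_expR R)) => //.
  apply: measurable_funM => //; exact: measurable_mahal.
- move=> y; rewrite addr0 !gauss_pdfE mulrA mul1r -expRD /mahal bformZl bformZr.
  by congr (expR _ / _); field.
Qed.

Hypothesis ST : S^T = S.

(** Completing the square in the Mahalanobis norm: 3/2 |y|^2 + 1/2 |y - eta|^2 = 1/2 |2 y - eta /
    2|^2 + 3/8 |eta|^2. *)
Lemma expectation_bump_lik_ratio eta :
  (\int[P]_w (expR (- (3 / 2) * mahal S (X w - mu)) * lik_ratio S (X w - mu) eta)%:E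
   = (2^-1 ^+ d * expR (- (3 / 8) * mahal S eta))%:E)%E.
Proof.
rewrite (expectation_normal_affine
  (fun y => expR (- (3 / 2) * mahal S y) * lik_ratio S y eta)
  (expR (- (3 / 8) * mahal S eta)) 2 (- (2^-1 *: eta)))//.
- by rewrite mulrC.
- apply: measurable_funM; last exact: measurable_lik_ratio.
  apply: (measurableT_comp (@measurable_expR R)) => //.
  apply: measurable_funM => //; exact: measurable_mahal.
- by move=> x; rewrite mulr_ge0 ?expR_ge0.
- move=> y; rewrite -mulrA lik_ratioM !gauss_pdfE !mulrA -!expRD.
  rewrite /mahal !(bformDl, bformDr, bformNl, bformNr, bformZl, bformZr).
  rewrite (bformC _ eta y) ?trmx_inv ?ST//.
  by congr (expR _ / _); field.
Qed.
End law.
End gaussian_expectations.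

(** * Separation of a mixture from the point mass *)

Lemma integral_probability_cst {R : realType} {dT : measure_display}
  {T : measurableType dT} (P : probability T R) (k : \bar R) :
  (\int[P]_x k = k)%E.
Proof.
transitivity (\int[P]_x cst k x)%E => //.
rewrite integral_cst; last exact: measurableT.
rewrite -[RHS]mule1; congr (_ * _)%E; exact: probability_setT.
Qed.

Section mixture_likelihood.
Context {R : realType} {d : nat} (a b : R) (S : 'M[R]_d) (mu : 'rV[R]_d).
Hypotheses (a0 : 0 < a) (b0 : 0 < b) (ST : S^T = S)
  (aS : loewner_le a%:M S) (Sb : loewner_le S b%:M).
Implicit Types (x y theta : 'rV[R]_d) (G : probability 'rV[R]_d R).

Lemma mahal_ge y : norm2 y ^+ 2 / b <= mahal S y.
Proof. exact: (bform_invmx_ge S a b). Qed.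

Lemma mahal_le y : mahal S y <= norm2 y ^+ 2 / a.
Proof. exact: (bform_invmx_le S a). Qed.

Lemma mahal_ge0 y : 0 <= mahal S y.
Proof. by apply: le_trans (mahal_ge y); rewrite divr_ge0 ?sqr_ge0// ltW. Qed.

Lemma lik_ratio_gt0 y theta : 0 < lik_ratio S y theta.
Proof. exact: expR_gt0. Qed.

Lemma lik_ratio_le y theta : lik_ratio S y theta <= expR (mahal S y / 2).
Proof. by rewrite ler_expR lerBlDr lerDl divr_ge0 ?mahal_ge0. Qed.

Definition lik G x : R := \int[G]_theta lik_ratio S (x - mu) (theta - mu).

Definition tau G : R := \int[G]_theta Num.min (norm2 (theta - mu) ^+ 2) 1.

Lemma measurable_lik_ratio_theta x :
  measurable_fun setT (fun theta => lik_ratio S (x - mu) (theta - mu)).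
Proof. by apply: measurable_lik_ratio => //; exact: measurable_funB_rV. Qed.

Lemma bounded_integrable G (f : 'rV[R]_d -> R) (K : R) (D : set 'rV[R]_d) :
  measurable D -> measurable_fun setT f -> (forall x, D x -> `|f x| <= K) ->
  G.-integrable D (EFin \o f).
Proof.
move=> mD mf fK; apply: (@le_integrable _ _ _ _ _ mD _ (EFin \o cst (`|K|))).
- by apply/measurable_EFinP; apply: measurable_funTS.
- move=> x Dx; rewrite lee_fin normr_id.
  by rewrite (le_trans (fK x Dx))// ler_norm.
- apply/integrableP; split; first exact/measurable_EFinP.
  rewrite (eq_integral (cst `|K|%:E)); last by move=> x _ /=; rewrite normr_id.
  rewrite integral_cst//.
  apply: (@le_lt_trans _ _ (`|K|%:E * 1)%E).
    by rewrite lee_wpmul2l ?lee_fin// probability_le1.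
  by rewrite mule1 ltry.
Qed.

Lemma integrable_lik_ratio G x (D : set 'rV[R]_d) : measurable D ->
  G.-integrable D (EFin \o (fun theta => lik_ratio S (x - mu) (theta - mu))).
Proof.
move=> mD; apply: (@bounded_integrable _ _ (expR (mahal S (x - mu) / 2))) => //.
  exact: measurable_lik_ratio_theta.
by move=> theta _; rewrite gtr0_norm ?lik_ratio_gt0// lik_ratio_le.
Qed.

Lemma EFin_lik G x :
  ((lik G x)%:E = \int[G]_theta (lik_ratio S (x - mu) (theta - mu))%:E)%E.
Proof.
rewrite /lik /Rintegral fineK//.
by apply: integrable_fin_num => //; exact: integrable_lik_ratio.
Qed.

Lemma lik_ge0 G x : 0 <= lik G x.
Proof. by apply: Rintegral_ge0 => theta _; rewrite ltW ?lik_ratio_gt0. Qed.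

Lemma lik_le G x : lik G x <= expR (mahal S (x - mu) / 2).
Proof.
rewrite -lee_fin EFin_lik.
apply: (@le_trans _ _ (\int[G]_theta (cst (expR (mahal S (x - mu) / 2))%:E theta))%E).
  apply: ge0_le_integral => //.
  - by move=> theta _; rewrite lee_fin ltW ?lik_ratio_gt0.
  - by apply/measurable_EFinP; exact: measurable_lik_ratio_theta.
  - by move=> theta _; rewrite lee_fin lik_ratio_le.
by rewrite integral_probability_cst.
Qed.

(** A positive integrand with integral 0 would vanish almost everywhere, making the whole space
    G-null. Positivity is needed to split logarithms of likelihoods. *)
Lemma lik_gt0 G x : 0 < lik G x.
Proof.
rewrite lt_neqAle lik_ge0 andbT eq_sym; apply/negP => /eqP L0.
have : (\int[G]_theta `|(lik_ratio S (x - mu) (theta - mu))%:E| = 0)%E.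
  rewrite -[RHS]/(0%:E) -L0 EFin_lik; apply: eq_integral => theta _.
  by rewrite gee0_abs// lee_fin ltW ?lik_ratio_gt0.
move/ae_eq_integral_abs => /(_ measurableT).
have m : measurable_fun setT (fun theta => (lik_ratio S (x - mu) (theta - mu))%:E).
  by apply/measurable_EFinP; exact: measurable_lik_ratio_theta.
move=> /(_ m) [N [mN N0 sub]].
have NT : N = setT.
  apply/seteqP; split => // theta _; apply: sub => /= /(_ I) [] /eqP.
  by rewrite gt_eqF// lik_ratio_gt0.
have N1 : G N = 1%E by rewrite NT; exact: probability_setT.
by move: (etrans (esym N0) N1) => /eqP; rewrite eqe eq_sym oner_eq0.
Qed.

Lemma gauss_mixE G x : gauss_mix G S x = lik G x * gauss_pdf S (x - mu).
Proof.
rewrite /gauss_mix /lik -RintegralZr//; last exact: integrable_lik_ratio.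
apply: eq_Rintegral => theta _; rewrite lik_ratioM.
by congr gauss_pdf; rewrite opprB addrA subrK.
Qed.

Lemma tau_integrable G : G.-integrable setT
  (EFin \o (fun theta => Num.min (norm2 (theta - mu) ^+ 2) 1)).
Proof.
apply: (@bounded_integrable _ _ 1) => //.
  apply: measurable_minr => //; apply: measurable_funX; apply: measurable_norm2.
  exact: measurable_funB_rV.
by move=> x _; rewrite ger0_norm ?le_min ?sqr_ge0 ?ler01//= ge_min lexx orbT.
Qed.

Lemma EFin_tau G :
  ((tau G)%:E = \int[G]_theta (Num.min (norm2 (theta - mu) ^+ 2) 1)%:E)%E.
Proof.
rewrite /tau /Rintegral fineK//.
by apply: integrable_fin_num => //; exact: tau_integrable.
Qed.

Lemma tau_ge0 G : 0 <= tau G.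
Proof. by apply: Rintegral_ge0 => x _; rewrite le_min sqr_ge0 ler01. Qed.

Lemma measurable_lik G : measurable_fun setT (lik G).
Proof.
have m : measurable_fun setT (fun p : 'rV[R]_d * 'rV[R]_d =>
    lik_ratio S (p.1 - mu) (p.2 - mu)).
  by apply: measurable_lik_ratio; apply: measurable_funB_rV.
apply/measurable_EFinP.
rewrite (_ : _ \o _ = fubini_F G
   (fun p : 'rV[R]_d * 'rV[R]_d => (lik_ratio S (p.1 - mu) (p.2 - mu))%:E)); last first.
  by apply/funext => x /=; rewrite EFin_lik.
apply: measurable_fun_fubini_tonelli_F.
- exact/measurable_EFinP.
- by move=> p; rewrite lee_fin ltW ?lik_ratio_gt0.
Qed.

Section expectation.
Context {dT : measure_display} {T : measurableType dT} (P : probability T R)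
  (X : T -> 'rV[R]_d).
Hypothesis HX : has_normal_law P X mu S.

Let mX : measurable_fun setT X := HX.1.

Lemma measurable_lik_comp G : measurable_fun setT (fun w => lik G (X w)).
Proof. exact: (measurableT_comp (measurable_lik G) mX). Qed.

Let measurable_lik_ratio_pair :
  measurable_fun setT (fun p : T * 'rV[R]_d => lik_ratio S (X p.1 - mu) (p.2 - mu)).
Proof.
apply: measurable_lik_ratio; apply: measurable_funB_rV => //.
by apply: (measurableT_comp mX).
Qed.

Lemma expectation_mul_lik G (h : T -> R) :
  measurable_fun setT h -> (forall w, 0 <= h w) ->
  (\int[P]_w (h w * lik G (X w))%:E
   = \int[G]_theta \int[P]_w (h w * lik_ratio S (X w - mu) (theta - mu))%:E)%E.
Proof.
move=> mh h0.
rewrite -(@fubini_tonelli _ _ _ _ _ P G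
   (fun p : T * 'rV[R]_d => (h p.1 * lik_ratio S (X p.1 - mu) (p.2 - mu))%:E)); last 2 first.
- apply/measurable_EFinP; apply: measurable_funM => //.
  by apply: (measurableT_comp mh).
- by move=> p; rewrite lee_fin mulr_ge0 ?h0// ltW ?lik_ratio_gt0.
apply: eq_integral => w _ /=; rewrite EFinM EFin_lik -ge0_integralZl//.
- by apply/measurable_EFinP; exact: measurable_lik_ratio_theta.
- by move=> theta _; rewrite lee_fin ltW ?lik_ratio_gt0.
- by rewrite lee_fin.
Qed.

Lemma expectation_lik G : (\int[P]_w (lik G (X w))%:E = 1)%E.
Proof.
under eq_integral do rewrite -[lik _ _]mul1r.
rewrite (expectation_mul_lik _ (cst 1))//.
under eq_integral => theta _.
  under eq_integral do rewrite /= mul1r.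
  rewrite (expectation_lik_ratio _ _ _ _ HX).
  over.
by rewrite integral_probability_cst.
Qed.

Let bump w := expR (- (3 / 2) * mahal S (X w - mu)).

Lemma measurable_mahal_sub : measurable_fun setT (fun w => mahal S (X w - mu)).
Proof. by apply: measurable_mahal; exact: measurable_funB_rV. Qed.

Let measurable_bump : measurable_fun setT bump.
Proof.
apply: (measurableT_comp (@measurable_expR R)) => //.
apply: measurable_funM => //; exact: measurable_mahal_sub.
Qed.

Lemma expectation_bump : (\int[P]_w (bump w)%:E = (2^-1 ^+ d)%:E)%E.
Proof.
have z0 : mahal S 0 = 0 by rewrite /mahal -(scale0r 0) bformZl mul0r.
have := expectation_bump_lik_ratio _ _ _ _ HX ST 0.
rewrite z0 mulr0 expR0 mulr1 => <-; apply: eq_integral => w _.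
by rewrite /lik_ratio subr0 subrr expR0 mulr1.
Qed.

(** A chord slope: with be = 3 / (8 b), exp(- be m) <= 1 / (1 + be m), and this convex function of m
    lies on [0, 1] below its chord, of slope - be / (1 + be). *)
Definition sep_const : R := 3 / (8 * b) / (1 + 3 / (8 * b)).

Lemma sep_const_gt0 : 0 < sep_const.
Proof.
by rewrite /sep_const divr_gt0// ?addr_gt0// divr_gt0// mulr_gt0.
Qed.

Lemma expR_mahal_le eta :
  expR (- (3 / 8) * mahal S eta)
    <= 1 - sep_const * Num.min (norm2 eta ^+ 2) 1.
Proof.
set m := Num.min _ _; pose be := 3 / (8 * b).
have be0 : 0 < be by rewrite divr_gt0// mulr_gt0.
have m0 : 0 <= m by rewrite le_min sqr_ge0 ler01.
have m1 : m <= 1 by rewrite ge_min lexx orbT.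
have mle : m <= norm2 eta ^+ 2 by rewrite ge_min lexx.
have u : be * m <= 3 / 8 * mahal S eta.
  have -> : be * m = 3 / 8 * (m / b) by rewrite /be; field; rewrite gt_eqF.
  rewrite ler_pM2l// (le_trans _ (mahal_ge _))// ler_pM2r ?invr_gt0//.
have p : 0 < 1 + be * m by rewrite ltr_pwDl// mulr_ge0// ltW.
apply: (@le_trans _ _ (1 + be * m)^-1).
  rewrite mulNr expRN lef_pV2 ?posrE ?expR_gt0//.
  by apply: le_trans (expR_ge1Dx _); rewrite lerD2l.
rewrite -[_^-1]mul1r ler_pdivrMr// /sep_const -/be.
have -> : (1 - be / (1 + be) * m) * (1 + be * m)
  = 1 + m * (be ^+ 2 / (1 + be)) * (1 - m).
  by field; rewrite gt_eqF// addr_gt0.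
rewrite lerDl; apply: mulr_ge0; last by rewrite subr_ge0.
by apply: mulr_ge0 => //; rewrite divr_ge0 ?sqr_ge0// addr_ge0// ltW.
Qed.

Lemma expectation_bump_lik G :
  (\int[P]_w (bump w * lik G (X w))%:E
    <= (2^-1 ^+ d * (1 - sep_const * tau G))%:E)%E.
Proof.
have m1 : measurable_fun setT (fun theta : 'rV[R]_d =>
    expR (- (3 / 8) * mahal S (theta - mu))).
  apply: (measurableT_comp (@measurable_expR R)) => //.
  by apply: measurable_funM => //; apply: measurable_mahal; exact: measurable_funB_rV.
rewrite expectation_mul_lik//; last by move=> w; exact: expR_ge0.
under eq_integral => theta _ do
  rewrite (expectation_bump_lik_ratio _ _ _ _ HX ST) EFinM.
rewrite ge0_integralZl//; last exact/measurable_EFinP.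
rewrite EFinM lee_wpmul2l ?lee_fin ?exprn_ge0//.
have mt : measurable_fun setT
    (fun theta : 'rV[R]_d => Num.min (norm2 (theta - mu) ^+ 2) 1).
  apply: measurable_minr => //; apply: measurable_funX; apply: measurable_norm2.
  exact: measurable_funB_rV.
have t0 theta : 0 <= Num.min (norm2 (theta - mu) ^+ 2) 1.
  by rewrite le_min sqr_ge0 ler01.
rewrite EFinB leeBrDr// EFinM EFin_tau -ge0_integralZl//; last 3 first.
- exact/measurable_EFinP.
- by move=> theta _; rewrite lee_fin.
- by rewrite lee_fin ltW// sep_const_gt0.
rewrite -ge0_integralD//; last 3 first.
- exact/measurable_EFinP.
- by move=> theta _; rewrite mule_ge0// lee_fin// ltW// sep_const_gt0.
- by apply: measurable_funeM; exact/measurable_EFinP.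
apply: (@le_trans _ _ (\int[G]_theta (cst 1 theta))%E).
  apply: ge0_le_integral => //.
  - move=> theta _; rewrite adde_ge0// ?mule_ge0// lee_fin ?expR_ge0//.
    by rewrite ltW// sep_const_gt0.
  - apply: emeasurable_funD; first exact/measurable_EFinP.
    by apply: measurable_funeM; exact/measurable_EFinP.
  - move=> theta _; rewrite -EFinM -EFinD lee_fin -lerBrDr.
    exact: expR_mahal_le.
by rewrite integral_probability_cst.
Qed.

(** With al = 2^-d [sep_const], the minimum over s of 1 + 2 s^2 - s al tau is 1 - al^2 tau^2 / 8. *)
Definition hell_const : R := (2^-1 ^+ d * sep_const) ^+ 2 / 8.

(** A pointwise form of the lower bound on the Hellinger distance by a bounded test g: it turns a
    gap linear in tau into one quadratic in tau. The terms are arranged so that both sides are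
    nonnegative and can be integrated in the extended reals. *)
Lemma sqrt_linear_bound (L g s : R) : 0 <= L -> 0 <= g <= 1 -> 0 <= s ->
  Num.sqrt L + s * g <= (2^-1 + s ^+ 2) * (1 + L) + s * (g * L).
Proof.
move=> L0 /andP[g0 g1] s0; set u := Num.sqrt L.
have -> : L = u ^+ 2 by rewrite sqr_sqrtr.
have u0 : 0 <= u := sqrtr_ge0 _.
(* [s g (1 - u)(1 + u) <= (1 - u)^2 / 2 + s^2 g^2 (1 + u)^2 / 2] *)
have := sqr_ge0 ((1 - u) - s * g * (1 + u)).
have : s ^+ 2 * (1 + u) ^+ 2 * g ^+ 2 <= s ^+ 2 * (2 * (1 + u ^+ 2)) * 1.
  have g2 : g ^+ 2 <= 1 by rewrite expr_le1.
  have u2 : (1 + u) ^+ 2 <= 2 * (1 + u ^+ 2) by have := sqr_ge0 (1 - u); nra.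
  apply: (@le_trans _ _ (s ^+ 2 * (1 + u) ^+ 2 * 1)).
    by apply: ler_wpM2l => //; apply: mulr_ge0; exact: sqr_ge0.
  by rewrite !mulr1; apply: ler_wpM2l => //; exact: sqr_ge0.
nra.
Qed.

Lemma expectation_sqrt_lik G :
  (\int[P]_w (Num.sqrt (lik G (X w)))%:E <= (1 - hell_const * tau G ^+ 2)%:E)%E.
Proof.
pose al := 2^-1 ^+ d * sep_const.
have al0 : 0 <= al by rewrite mulr_ge0 ?exprn_ge0// ltW// sep_const_gt0.
(* The minimiser of 1 + 2 s^2 - s al tau. *)
pose s := al * tau G / 4.
have s0 : 0 <= s by rewrite divr_ge0// mulr_ge0// tau_ge0.
have mL := measurable_lik_comp G.
have msq : measurable_fun setT (fun w => Num.sqrt (lik G (X w))).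
  exact: (measurableT_comp (continuous_measurable_fun (@sqrt_continuous R))).
have K0 : 0 <= 2^-1 + s ^+ 2 by rewrite addr_ge0// sqr_ge0.
have step : (\int[P]_w (Num.sqrt (lik G (X w)))%:E + (s * 2^-1 ^+ d)%:E
   <= ((2^-1 + s ^+ 2) * 2)%:E + (s * (2^-1 ^+ d * (1 - sep_const * tau G)))%:E)%E.
  rewrite EFinM -expectation_bump -ge0_integralZl//; last 2 first.
  - exact/measurable_EFinP.
  - by move=> w _; rewrite lee_fin expR_ge0.
  rewrite -ge0_integralD//; last 3 first.
  - exact/measurable_EFinP.
  - by move=> w _; rewrite mule_ge0// lee_fin// expR_ge0.
  - by apply: measurable_funeM; exact/measurable_EFinP.
  apply: (@le_trans _ _ (\int[P]_w ((2^-1 + s ^+ 2)%:E * (1 + (lik G (X w))%:E)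
       + s%:E * (bump w * lik G (X w))%:E))%E).
    apply: ge0_le_integral => //.
    - by move=> w _; rewrite adde_ge0 ?mule_ge0// lee_fin ?sqrtr_ge0 ?expR_ge0.
    - apply: emeasurable_funD; first exact/measurable_EFinP.
      by apply: measurable_funeM; exact/measurable_EFinP.
    - apply: emeasurable_funD; apply: measurable_funeM.
        apply: emeasurable_funD => //; exact/measurable_EFinP.
      by apply/measurable_EFinP; apply: measurable_funM.
    - move=> w _.
      have bump01 : 0 <= bump w <= 1.
        rewrite expR_ge0/= -expR0 ler_expR mulNr oppr_le0 mulr_ge0//.
        exact: mahal_ge0.
      have := sqrt_linear_bound _ _ _ (lik_ge0 G (X w)) bump01 s0.
      by rewrite -lee_fin.
  rewrite ge0_integralD//; last 4 first.
  - move=> w _; apply: mule_ge0; first by rewrite lee_fin.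
    by apply: adde_ge0 => //; rewrite lee_fin lik_ge0.
  - apply: measurable_funeM.
    by apply: emeasurable_funD => //; exact/measurable_EFinP.
  - move=> w _; apply: mule_ge0; rewrite lee_fin//.
    by rewrite mulr_ge0 ?expR_ge0 ?lik_ge0.
  - by apply: measurable_funeM; apply/measurable_EFinP; apply: measurable_funM.
  have mK : measurable_fun setT (fun w => 1 + (lik G (X w))%:E)%E.
    by apply: emeasurable_funD => //; exact/measurable_EFinP.
  have K1 w : setT w -> (0 <= 1 + (lik G (X w))%:E)%E.
    by move=> _; apply: adde_ge0 => //; rewrite lee_fin lik_ge0.
  have mB : measurable_fun setT (fun w => (bump w * lik G (X w))%:E).
    by apply/measurable_EFinP; apply: measurable_funM.
  have B0 w : setT w -> (0 <= (bump w * lik G (X w))%:E)%E.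
    by move=> _; rewrite lee_fin mulr_ge0 ?expR_ge0 ?lik_ge0.
  rewrite (ge0_integralZl_EFin P measurableT K1 mK K0).
  rewrite (ge0_integralZl_EFin P measurableT B0 mB s0).
  rewrite ge0_integralD//; last 2 first.
  - by move=> w _; rewrite lee_fin lik_ge0.
  - exact/measurable_EFinP.
  rewrite expectation_lik integral_probability_cst.
  rewrite leeD//.
  rewrite [leRHS]EFinM; apply: lee_wpmul2l; rewrite ?lee_fin//; exact: expectation_bump_lik.
have -> : 1 - hell_const * tau G ^+ 2 =
   (2^-1 + s ^+ 2) * 2 + s * (2^-1 ^+ d * (1 - sep_const * tau G)) - s * 2^-1 ^+ d.
  by rewrite /hell_const /s /al; field.
by rewrite EFinB leeBrDr// EFinD.
Qed.
End expectation.
End mixture_likelihood.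

(** * Products over independent observations *)

Section independence.
Context {R : realType} {d n : nat} {dT : measure_display}
  {T : measurableType dT} (P : probability T R) (X : 'I_n -> T -> 'rV[R]_d).
Hypotheses (mX : forall i, measurable_fun setT (X i))
  (indep : mutually_independent P X).

(** Independence is given for events, so indicators are replaced by the functions [g i] one index at
    a time. At stage k the factors of index at least k are indicators of arbitrary sets, and this
    arbitrariness is what allows the next replacement. *)
Lemma expectation_prod (g : 'I_n -> 'rV[R]_d -> R) (e : 'I_n -> R) :
  (forall i, measurable_fun setT (g i)) -> (forall i x, 0 <= g i x) ->
  (forall i, (\int[P]_w (g i (X i w))%:E = (e i)%:E)%E) ->
  (\int[P]_w (\prod_i g i (X i w))%:E = (\prod_i e i)%:E)%E.
Proof.
move=> mg g0 ge.
pose f k (A : 'I_n -> set 'rV[R]_d) (i : 'I_n) x : R :=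
  if (i < k)%N then g i x else \1_(A i) x.
pose c k (A : 'I_n -> set 'rV[R]_d) (i : 'I_n) : R :=
  if (i < k)%N then e i else fine (P (X i @^-1` A i)).
have mpre i A : measurable A -> measurable (X i @^-1` A).
  by move=> mA; rewrite -[X in measurable X]setTI; apply: mX.
have e0 i : 0 <= e i by rewrite -lee_fin -ge integral_ge0// => w _; rewrite lee_fin.
have f0 k A i x : 0 <= f k A i x by rewrite /f; case: ifP.
have mf k A i : measurable (A i) -> measurable_fun setT (f k A i).
  by move=> mA; rewrite /f; case: (i < k)%N => //; exact: measurable_indic.
suff main k : (k <= n)%N -> forall A, (forall i, measurable (A i)) ->
    (\int[P]_w (\prod_i f k A i (X i w))%:E = (\prod_i c k A i)%:E)%E.
  have := main n (leqnn n) (fun=> setT) (fun=> measurableT).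
  rewrite (eq_bigr e); last by move=> i _; rewrite /c ltn_ord.
  move=> <-; apply: eq_integral => w _; congr EFin.
  by apply: eq_bigr => i _; rewrite /f ltn_ord.
elim: k => [_ A mA|k IH kn A mA].
  pose Icap := \bigcap_(i in [set` [set: 'I_n]%SET]) (X i @^-1` A i).
  have mI : measurable Icap.
    by apply: fin_bigcap_measurable => // i _; exact: mpre.
  transitivity (P (Icap)).
    transitivity (\int[P]_w
        (\1_Icap w)%:E)%E.
      apply: eq_integral => w _; congr EFin; rewrite indicE.
      have [wI|wI] := boolP (w \in Icap).
        rewrite big1 // => i _.
        rewrite /f ltn0 indicE mem_set //.
        by move: wI; rewrite inE => /(_ i); apply; rewrite /= finset.in_setT.
      have [i iA] : exists i, X i w \notin A i.
        apply: contrapT => /forallNP H; move/negP: wI; apply.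
        by rewrite inE => i _ /=; have /negP := H i; rewrite negbK => /set_mem.
      by rewrite (bigD1 i)//= /f ltn0 indicE (negbTE iA) mul0r.
    by rewrite integral_indic// setIT.
  rewrite /Icap indep//.
  rewrite (eq_bigr (fun i => (fine (P (X i @^-1` A i)))%:E)); last first.
    by move=> i _; rewrite fineK// fin_num_measure//; exact: mpre.
  rewrite prodEFin; congr EFin; apply: eq_bigl => i; exact: finset.in_setT.
pose i0 := Ordinal kn.
have lt0 i : i != i0 -> (i < k.+1)%N = (i < k)%N.
  by rewrite -val_eqE /= ltnS leq_eqVlt => /negbTE ->.
pose W w := \prod_(i | i != i0) f k A i (X i w).
pose C := \prod_(i | i != i0) c k A i.
have C0 : 0 <= C.
  apply: prodr_ge0 => i _; rewrite /c; case: ifP => // _.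
  by rewrite fine_ge0.
have mW : measurable_fun setT W.
  rewrite /W; under eq_fun do rewrite -big_filter.
  apply: measurable_prod => i _; apply: measurableT_comp => //; exact: mf.
have W0 w : 0 <= W w by apply: prodr_ge0.
(* Putting B at index i0 in the induction hypothesis shows that the product W of the other factors
   integrates like the constant C over every event of [X i0]. *)
have H B : measurable B ->
   (\int[P]_(w in X i0 @^-1` B) (W w)%:E = \int[P]_(w in X i0 @^-1` B) C%:E)%E.
  move=> mB; pose A' i := if i == i0 then B else A i.
  have mA' i : measurable (A' i) by rewrite /A'; case: ifP.
  have := IH (ltnW kn) A' mA'.
  rewrite (bigD1 i0)//= {1}/c ltnn /A' eqxx.
  rewrite (eq_bigr (c k A)) -/C; last first.
    by move=> i /negbTE ii0; rewrite /c ii0.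
  move=> E; transitivity ((fine (P (X i0 @^-1` B)) * C)%:E)%E.
    rewrite -E integral_mkcond; apply: eq_integral => w _.
    rewrite patchE (bigD1 i0)//= {1}/f ltnn eqxx indicE.
    rewrite (eq_bigr (fun i => f k A i (X i w))) -/(W w); last first.
      by move=> i /negbTE ii0; rewrite /f ii0.
    rewrite (_ : (X i0 w \in B) = (w \in X i0 @^-1` B)); last first.
      by apply/idP/idP; rewrite !inE.
    by case: ifP => _; rewrite ?mul1r ?mul0r.
  rewrite integral_cst; last exact: mpre.
  by rewrite muleC EFinM fineK// fin_num_measure//; exact: mpre.
have := eq_weighted_integral P P (X i0) (X i0) W (cst C) (EFin \o g i0)
  (mX i0) (mX i0) mW.
move=> /(_ (measurable_cst _) W0 (fun=> C0)) /=.
have mgE : measurable_fun setT (EFin \o g i0) by exact/measurable_EFinP.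
have gE0 u : (0 <= (g i0 u)%:E)%E by rewrite lee_fin.
move=> /(_ mgE gE0 H) E.
rewrite (bigD1 i0)//= {1}/c ltnSn.
rewrite (eq_bigr (c k A)) -/C; last by move=> i ii0; rewrite /c lt0.
rewrite EFinM -ge -ge0_integralZr//; last first.
  by apply/measurable_EFinP; exact: measurableT_comp.
rewrite -E.
apply: eq_integral => w _; rewrite (bigD1 i0)//= {1}/f ltnSn EFinM.
congr (_ * EFin _)%E; apply: eq_bigr => i ii0; by rewrite /f lt0.
Qed.
End independence.

(** * Polynomial approximation and moments *)

Section hull.
Context {R : realType} {d : nat}.
Implicit Types (u : 'rV[R]_d) (f g : 'rV[R]_d -> R) (al be : 'I_d -> nat).

Definition monomial al u : R := \prod_j u ord0 j ^+ al j.

(* [hull m B f]: [f] is a linear combination of monomials with all exponents at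
   most [m], whose coefficients have absolute values adding up to at most [B]. *)
Inductive hull (m : nat) : R -> ('rV[R]_d -> R) -> Prop :=
| hull_monomial al : (forall j, (al j <= m)%N) -> hull m 1 (monomial al)
| hull_scale r B f : hull m B f -> hull m (`|r| * B) (fun u => r * f u)
| hull_add B1 B2 f1 f2 : hull m B1 f1 -> hull m B2 f2 ->
    hull m (B1 + B2) (fun u => f1 u + f2 u)
| hull_weaken B1 B2 f : hull m B1 f -> B1 <= B2 -> hull m B2 f.

Lemma hull_ge0 {m B f} : hull m B f -> 0 <= B.
Proof.
elim=> [//|r {}B {}f _ B0|B1 B2 f1 f2 _ B10 _ B20|B1 B2 {}f _ B10 B12].
- by rewrite mulr_ge0.
- by rewrite addr_ge0.
- exact: le_trans B12.
Qed.

Lemma hull_deg {m m' B f} : (m <= m')%N -> hull m B f -> hull m' B f.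
Proof.
move=> mm; elim=> [al H|r {}B {}f _ IH|B1 B2 f1 f2 _ IH1 _ IH2|B1 B2 {}f _ IH B12].
- by apply: hull_monomial => j; exact: leq_trans (H j) mm.
- exact: hull_scale.
- exact: hull_add.
- exact: hull_weaken B12.
Qed.

Lemma hull_const m r : hull m `|r| (fun=> r).
Proof.
have -> : (fun=> r) = (fun u => r * monomial (fun=> 0%N) u).
  by apply/funext => u; rewrite /monomial big1 ?mulr1// => j _; rewrite expr0.
by rewrite -[`|r|]mulr1; apply: hull_scale; exact: hull_monomial.
Qed.

Lemma hull_coord m j : (0 < m)%N -> hull m 1 (fun u => u ord0 j).
Proof.
move=> m0; rewrite (_ : (fun _ => _) = monomial (fun i => (i == j) : nat)).
  by apply: hull_monomial => i; case: eqP.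
apply/funext => u; rewrite /monomial (bigD1 j)//= eqxx expr1 big1 ?mulr1//.
by move=> i /negbTE ->; rewrite expr0.
Qed.

(** A nested induction over both derivations: exponents add, and the sum of absolute coefficients is
    submultiplicative. *)
Lemma hull_mul {m1 m2 B1 B2 f1 f2} : hull m1 B1 f1 -> hull m2 B2 f2 ->
  hull (m1 + m2) (B1 * B2) (fun u => f1 u * f2 u).
Proof.
move=> h1 h2; have B20 := hull_ge0 h2.
elim: h1 => [al H|r B f _ IH|B B' f f' _ IH _ IH'|B B' f _ IH BB'].
- rewrite mul1r; elim: h2 {B20} => [be H'|r B f _ IH|B B' f f' _ IH _ IH'|B B' f _ IH BB'].
  + rewrite (_ : (fun _ => _) = monomial (fun j => (al j + be j)%N)).
      by apply: hull_monomial => j; rewrite leq_add.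
    apply/funext => u; rewrite /monomial -big_split/=.
    by apply: eq_bigr => j _; rewrite exprD.
  + rewrite (_ : (fun _ => _) = (fun u => r * (monomial al u * f u))).
      exact: hull_scale.
    by apply/funext => u; rewrite mulrCA.
  + rewrite (_ : (fun _ => _) = (fun u => monomial al u * f u + monomial al u * f' u)).
      exact: hull_add.
    by apply/funext => u; rewrite mulrDr.
  + exact: hull_weaken BB'.
- rewrite -mulrA (_ : (fun _ => _) = (fun u => r * (f u * f2 u))).
    exact: hull_scale.
  by apply/funext => u; rewrite mulrA.
- rewrite mulrDl (_ : (fun _ => _) = (fun u => f u * f2 u + f' u * f2 u)).
    exact: hull_add.
  by apply/funext => u; rewrite mulrDl.
- by apply: hull_weaken IH _; rewrite ler_wpM2r.
Qed.

Lemma hull_exp {m B f} k : hull m B f -> hull (k * m) (B ^+ k) (fun u => f u ^+ k).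
Proof.
move=> h; elim: k => [|k IH].
  rewrite expr0 (_ : (fun _ => _) = fun=> 1).
    by have := hull_const (0 * m) 1; rewrite normr1.
  by apply/funext => u; rewrite expr0.
rewrite mulSn exprS (_ : (fun _ => _) = (fun u => f u * f u ^+ k)).
  exact: hull_mul.
by apply/funext => u; rewrite exprS.
Qed.

Lemma hull_sum (I : Type) (s : seq I) m (B : I -> R) (f : I -> 'rV[R]_d -> R) :
  (forall i, hull m (B i) (f i)) ->
  hull m (\sum_(i <- s) B i) (fun u => \sum_(i <- s) f i u).
Proof.
move=> H; elim: s => [|i s IH].
  rewrite big_nil (_ : (fun _ => _) = fun=> 0).
    by have := hull_const m 0; rewrite normr0.
  by apply/funext => u; rewrite big_nil.
rewrite big_cons (_ : (fun _ => _) = (fun u => f i u + \sum_(j <- s) f j u)).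
  exact: hull_add.
by apply/funext => u; rewrite big_cons.
Qed.

Lemma hull_bound {m B f u} : hull m B f -> (forall j, `|u ord0 j| <= 1) ->
  `|f u| <= B.
Proof.
move=> h u1; elim: h => [al H|r {}B {}f _ IH|B1 B2 f1 f2 _ IH1 _ IH2|B1 B2 {}f _ IH B12].
- rewrite /monomial normr_prod.
  apply: (@le_trans _ _ (\prod_(j < d) 1)); last by rewrite big1.
  by apply: ler_prod => j _; rewrite normr_ge0 normrX exprn_ile1.
- by rewrite normrM ler_wpM2l.
- by rewrite (le_trans (ler_normD _ _))// lerD.
- exact: le_trans B12.
Qed.

Lemma hull_measurable {m B f} {dT : measure_display} {T : measurableType dT}
    (k : T -> 'rV[R]_d) : hull m B f -> measurable_fun setT k ->
  measurable_fun setT (fun t => f (k t)).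
Proof.
move=> h mk; elim: h => [al H|r {}B {}f _ IH|B1 B2 f1 f2 _ IH1 _ IH2|//].
- apply: measurable_prod => j _; apply: measurable_funX.
  exact: measurable_fun_coord.
- exact: measurable_funM.
- exact: measurable_funD.
Qed.
End hull.

(** * Taylor polynomials of the exponential *)

Section exponential_series.
Context {R : realType}.

Definition exp_poly (D : nat) (x : R) : R := \sum_(0 <= k < D) x ^+ k / k`!%:R.

Lemma exp_poly_le D (x : R) : 0 <= x -> exp_poly D x <= expR x.
Proof.
move=> x0; apply: nondecreasing_cvgn_le; last exact: is_cvg_series_exp_coeff.
by apply: nondecreasing_series => k _ _; rewrite /exp_coeff /= divr_ge0// exprn_ge0.
Qed.

(** For k >= D one has |x|^k <= 2^-D (2 B)^k, so the tail of the series is at most 2^-D exp(2 B). *)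
Lemma exp_poly_error D (x B : R) : `|x| <= B ->
  `|expR x - exp_poly D x| <= 2^-1 ^+ D * expR (2 * B).
Proof.
move=> xB; have B0 : 0 <= B := le_trans (normr_ge0 _) xB.
have step m : (D <= m)%N ->
    `|exp_poly m x - exp_poly D x| <= 2^-1 ^+ D * expR (2 * B).
  move=> Dm; rewrite /exp_poly (big_cat_nat (n := D))//= addrAC subrr add0r.
  apply: le_trans (ler_norm_sum _ _ _) _.
  apply: (@le_trans _ _ (2^-1 ^+ D * exp_poly m (2 * B))); last first.
    by rewrite ler_wpM2l ?exprn_ge0// exp_poly_le// mulr_ge0.
  rewrite /exp_poly [in leRHS](big_cat_nat (n := D))//= mulrDr -[leLHS]add0r.
  apply: lerD.
    rewrite mulr_ge0 ?exprn_ge0// sumr_ge0// => k _.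
    by rewrite divr_ge0// exprn_ge0// mulr_ge0.
  rewrite mulr_sumr big_nat_cond [leRHS]big_nat_cond; apply: ler_sum => k.
  rewrite andbT => /andP[Dk _].
  rewrite normrM normfV (ger0_norm (ler0n _ _)) mulrA ler_pM2r ?invr_gt0 ?ltr0n ?fact_gt0//.
  rewrite normrX exprMn mulrA.
  apply: (@le_trans _ _ (1 * B ^+ k)).
    by rewrite mul1r lerXn2r ?nnegrE.
  rewrite ler_wpM2r ?exprn_ge0// -(subnK Dk) exprD mulrCA -exprMn mulVf//.
  by rewrite expr1n mulr1 exprn_ege1// ler1n.
have cv : `|exp_poly m x - exp_poly D x| @[m --> \oo] --> `|expR x - exp_poly D x|.
  apply: cvg_norm; apply: cvgB; last exact: cvg_cst.
  exact: is_cvg_series_exp_coeff.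
rewrite -(cvg_lim _ cv)//; apply: limr_le; first exact: cvgP cv.
by exists D.
Qed.
End exponential_series.

(** * Local moments and the likelihoods they determine *)

Section moments.
Context {R : realType} {d : nat} (mu : 'rV[R]_d) (M : R).
Hypothesis M0 : 0 < M.
Implicit Types (G : probability 'rV[R]_d R) (theta u y : 'rV[R]_d).

Definition near_set : set 'rV[R]_d := [set theta | norm2 (theta - mu) <= M].

Definition rescale theta : 'rV[R]_d := M^-1 *: (theta - mu).

Lemma measurable_near_set : measurable near_set.
Proof.
rewrite (_ : near_set = (fun theta => norm2 (theta - mu)) @^-1` `]-oo, M]%classic).
  rewrite -[X in measurable X]setTI.
  by apply: (measurable_norm2 (fun theta => theta - mu)) => //; exact: measurable_funB_rV.
by apply/seteqP; split => theta; rewrite /near_set /= in_itv.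
Qed.

Lemma measurable_rescale : measurable_fun setT rescale.
Proof.
rewrite (_ : rescale = (fun v => M^-1 *: v + (- (M^-1 *: mu)))).
  exact: measurable_fun_affine.
by apply/funext => v; rewrite /rescale scalerBr.
Qed.

Lemma rescale_coord theta j : near_set theta -> `|rescale theta ord0 j| <= 1.
Proof.
move=> Nt; apply: le_trans (coord_le_norm2 _ j) _.
by rewrite norm2Z gtr0_norm ?invr_gt0// mulrC ler_pdivrMr// mul1r.
Qed.

Lemma rescaleK theta : M *: rescale theta = theta - mu.
Proof. by rewrite scalerA mulfV ?gt_eqF// scale1r. Qed.

(** The restriction of G to the ball is not renormalised; rescaling puts all moments in [-1, 1], the
    range that the net discretises. *)
Definition moment G (al : 'I_d -> nat) : R :=
  \int[G]_(theta in near_set) monomial al (rescale theta).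

Lemma hull_integrable m B f G : hull m B f ->
  G.-integrable near_set (EFin \o (f \o rescale)).
Proof.
move=> h; apply: (bounded_integrable _ _ B); first exact: measurable_near_set.
  exact: (hull_measurable _ h measurable_rescale).
by move=> theta Nt; apply: (hull_bound h) => j; exact: rescale_coord.
Qed.

(** By linearity, the coefficient sum B is the factor by which an error in the monomial moments can
    grow. *)
Lemma hull_integral_close m B f G1 G2 (e : R) : hull m B f ->
  (forall al, (forall j, (al j <= m)%N) -> `|moment G1 al - moment G2 al| <= e) ->
  `|\int[G1]_(theta in near_set) f (rescale theta)
    - \int[G2]_(theta in near_set) f (rescale theta)| <= B * e.
Proof.
move=> h close; have mN := measurable_near_set.
elim: h => [al H|r {}B {}f h IH|B1 B2 f1 f2 h1 IH1 h2 IH2|B1 B2 {}f h IH B12].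
- by rewrite mul1r; exact: close.
- rewrite !RintegralZl//; [|exact: hull_integrable h|exact: hull_integrable h].
  by rewrite -mulrBr normrM -mulrA ler_wpM2l.
- rewrite !RintegralD//; [|exact: hull_integrable h1|exact: hull_integrable h2
    |exact: hull_integrable h1|exact: hull_integrable h2].
  by rewrite opprD addrACA mulrDl (le_trans (ler_normD _ _))// lerD.
- apply: le_trans IH _; apply: ler_wpM2r => //.
  (* The zero exponent is admissible, so e bounds an absolute value and is nonnegative. *)
  by apply: le_trans (close (fun=> 0%N) _).
Qed.

Lemma moment_le1 G al : `|moment G al| <= 1.
Proof.
have h : hull (\max_j al j) 1 (@monomial R d al).
  by apply: hull_monomial => j; exact: leq_bigmax.
have mN := measurable_near_set; have hi := hull_integrable _ _ _ G h.
apply: le_trans (le_normr_Rintegral _ _) _ => //.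
apply: (@le_trans _ _ (\int[G]_(theta in near_set) 1)).
  apply: le_Rintegral => //.
  - rewrite (_ : EFin \o _ = abse \o (EFin \o (monomial al \o rescale)))//.
    exact: integrable_abse.
  - by apply: (bounded_integrable _ _ 1) => // x _; rewrite normr1.
  - by move=> theta Nt; apply: (hull_bound h) => j; exact: rescale_coord.
rewrite Rintegral_cst// mul1r -lee_fin fineK ?fin_num_measure//.
exact: probability_le1.
Qed.

Section likelihood.
Variables (a b : R) (S : 'M[R]_d) (M1 : R).
Hypotheses (a0 : 0 < a) (b0 : 0 < b) (ST : S^T = S)
  (aS : loewner_le a%:M S) (Sb : loewner_le S b%:M) (M10 : 0 <= M1).

(** Nonnegativity of the form at e_i + e_j and e_i - e_j bounds twice the entry by the sum of two
    diagonal entries, each at most 1/a. *)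
Lemma invmx_entry_le i j : `|invmx S i j| <= a^-1.
Proof.
have AT : (invmx S)^T = invmx S by rewrite trmx_inv ST.
pose e k : 'rV[R]_d := delta_mx ord0 k.
have bE k l : bform (invmx S) (e k) (e l) = invmx S k l.
  by rewrite /bform -rowE trmx_delta -colE !mxE.
have n1 k : norm2 (e k) ^+ 2 = 1.
  rewrite norm2_sqr (bigD1 k)//= /e mxE !eqxx expr1n big1 ?addr0// => l lk.
  by rewrite mxE eqxx (negbTE lk) expr0n.
have diag k : invmx S k k <= a^-1.
  have := mahal_le a S a0 ST aS (e k).
  by rewrite /mahal bE n1 mul1r.
have := mahal_ge0 a b S a0 b0 ST aS Sb (e i + e j).
have := mahal_ge0 a b S a0 b0 ST aS Sb (e i - e j).
rewrite /mahal !(bformDl, bformDr, bformNl, bformNr) !bE.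
have sym : invmx S j i = invmx S i j by rewrite -{1}AT mxE.
rewrite sym ler_norml; have := diag i; have := diag j; lra.
Qed.

Definition log_lik_ratio y u : R :=
  bform (invmx S) y (M *: u) - bform (invmx S) (M *: u) (M *: u) / 2.

Lemma lik_ratio_rescale y theta :
  lik_ratio S y (theta - mu) = expR (log_lik_ratio y (rescale theta)).
Proof.
have AT : (invmx S)^T = invmx S by rewrite trmx_inv ST.
rewrite /lik_ratio /log_lik_ratio rescaleK /mahal; congr expR.
move: (theta - mu) => eta.
rewrite !(bformDl, bformDr, bformNl, bformNr) (bformC _ eta y) //.
by field.
Qed.

Definition log_lik_bound : R := d%:R ^+ 2 / a * (M1 * M + M ^+ 2 / 2).

Lemma hull_log_lik_ratio y : norm2 y <= M1 ->
  hull 2 log_lik_bound (log_lik_ratio y).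
Proof.
move=> yM.
have -> : log_lik_ratio y = (fun u => (\sum_i \sum_j
    (M * (invmx S i j * y ord0 i)) * u ord0 j) + - (M ^+ 2 / 2) * (\sum_i \sum_j
    invmx S i j * (u ord0 i * u ord0 j))).
  apply/funext => u; rewrite /log_lik_ratio !(bformZl, bformZr) !bformE.
  rewrite mulr_sumr mulNr; congr (_ - _).
    by apply: eq_bigr => i _; rewrite mulr_sumr; apply: eq_bigr => j _; rewrite mulrA.
  rewrite (eq_bigr (fun i => \sum_j invmx S i j * (u ord0 i * u ord0 j))).
    by field.
  by move=> i _; apply: eq_bigr => j _; rewrite mulrA.
have sumd (K : R) : \sum_(i < d) \sum_(j < d) K = d%:R ^+ 2 * K.
  by rewrite !sumr_const !card_ord -mulrnA -[LHS]mulr_natl natrM expr2.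
have -> : log_lik_bound = (\sum_(i < d) \sum_(j < d) (M * (a^-1 * M1)))
     + (M ^+ 2 / 2) * (\sum_(i < d) \sum_(j < d) a^-1).
  by rewrite !sumd /log_lik_bound; ring.
apply: hull_add.
  apply: hull_sum => i; apply: hull_sum => j.
  apply: (hull_weaken _ (`|M * (invmx S i j * y ord0 i)| * 1)).
    by apply: hull_scale; exact: hull_coord.
  rewrite mulr1 normrM (gtr0_norm M0) ler_pM2l// normrM.
  apply: ler_pM => //; first exact: invmx_entry_le.
  exact: le_trans (coord_le_norm2 _ i) yM.
rewrite -[X in X * _](_ : `|- (M ^+ 2 / 2)| = _); last first.
  by rewrite normrN ger0_norm// divr_ge0// sqr_ge0.
apply: hull_scale; apply: hull_sum => i; apply: hull_sum => j.
apply: (hull_weaken _ (`|invmx S i j| * (1 * 1))).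
  apply: hull_scale; apply: (@hull_mul _ _ 1 1); exact: hull_coord.
by rewrite !mulr1 invmx_entry_le.
Qed.

(** The Taylor error is paid under G1 and again under G2, hence the factor 2. The coefficients of
    the Taylor polynomial add up to at most the exponential of [log_lik_bound]. *)
Lemma integral_lik_ratio_close (D : nat) (e : R) G1 G2 x :
  norm2 (x - mu) <= M1 ->
  (forall al, (forall j, (al j <= D * 2)%N) -> `|moment G1 al - moment G2 al| <= e) ->
  \int[G1]_(theta in near_set) lik_ratio S (x - mu) (theta - mu) <=
  \int[G2]_(theta in near_set) lik_ratio S (x - mu) (theta - mu)
   + (2 * (2^-1 ^+ D * expR (2 * log_lik_bound)) + expR log_lik_bound * e).
Proof.
move=> xM close; have mN := measurable_near_set.
have e0 : 0 <= e by apply: le_trans (close (fun=> 0%N) _).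
set B := log_lik_bound.
have hL := hull_log_lik_ratio _ xM; have B0 := hull_ge0 hL.
pose p u := exp_poly D (log_lik_ratio (x - mu) u).
have hp : hull (D * 2) (expR B) p.
  apply: (hull_weaken _ (exp_poly D B)); last exact: exp_poly_le.
  (* [hull_sum] asks for a bound at every index, but the degree 2 k is at most 2 D only for k < D;
     hence the default 0 beyond. *)
  rewrite /p /exp_poly (_ : (fun u => _) = (fun u =>
    \sum_(k <- index_iota 0 D) (if (k < D)%N then
       (k`!%:R^-1) * log_lik_ratio (x - mu) u ^+ k else 0))); last first.
    apply/funext => u; apply: eq_big_nat => k /andP[_ kD].
    by rewrite kD mulrC.
  rewrite big_nat (eq_bigr (fun k => if (k < D)%N then (k`!%:R^-1) * B ^+ k else 0)).
    rewrite -big_nat; apply: hull_sum => k; case: (ltnP k D) => kD; last first.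
      by have := @hull_const R d (D * 2) 0; rewrite normr0.
    rewrite -{1}[k`!%:R^-1]ger0_norm ?invr_ge0//; apply: hull_scale.
    apply: (@hull_deg _ _ (k * 2)); first by rewrite leq_mul2r/= ltnW.
    exact: hull_exp.
  by move=> k /andP[_ kD]; rewrite kD mulrC.
set er := 2^-1 ^+ D * expR (2 * B).
have pE theta : near_set theta ->
    `|lik_ratio S (x - mu) (theta - mu) - p (rescale theta)| <= er.
  move=> Nt; rewrite lik_ratio_rescale; apply: exp_poly_error.
  by apply: (hull_bound hL) => j; exact: rescale_coord.
have ip G : G.-integrable near_set (EFin \o (fun theta => p (rescale theta))).
  exact: hull_integrable hp.
have ic G : G.-integrable near_set (EFin \o (fun=> er)).
  by apply: (bounded_integrable _ _ `|er|).
have il G : G.-integrable near_set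
    (EFin \o (fun theta => lik_ratio S (x - mu) (theta - mu))).
  exact: (integrable_lik_ratio a b).
have er0 : 0 <= er by rewrite mulr_ge0 ?exprn_ge0// expR_ge0.
have cst_le G : \int[G]_(theta in near_set) er <= er.
  rewrite Rintegral_cst//; apply: ler_piMr => //.
  by rewrite -lee_fin fineK ?fin_num_measure//; exact: probability_le1.
have := hull_integral_close _ _ _ _ _ _ hp close.
rewrite ler_norml => /andP[_ C].
have U : \int[G1]_(theta in near_set) lik_ratio S (x - mu) (theta - mu) <=
   \int[G1]_(theta in near_set) p (rescale theta) + er.
  apply: le_trans (lerD (lexx _) (cst_le G1)).
  rewrite -(RintegralD mN (ip G1) (ic G1)).
  apply: (le_Rintegral mN (il G1)).
    exact: (integrableD mN (ip G1) (ic G1)).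
  by move=> theta Nt; rewrite -lerBlDl; apply: le_trans (pE _ Nt); rewrite ler_norm.
have L : \int[G2]_(theta in near_set) p (rescale theta) <=
   \int[G2]_(theta in near_set) lik_ratio S (x - mu) (theta - mu) + er.
  apply: le_trans (lerD (lexx _) (cst_le G2)).
  rewrite -(RintegralD mN (il G2) (ic G2)).
  apply: (le_Rintegral mN (ip G2)).
    exact: (integrableD mN (il G2) (ic G2)).
  move=> theta Nt; rewrite -lerBlDl; apply: le_trans (pE _ Nt).
  by rewrite distrC ler_norm.
lra.
Qed.

(** One direction suffices, with G1 the mixture to be controlled and G2 a net point. The far atoms
    of G2 are dropped; those of G1 are at distance at least M - M1 from x, which makes their
    likelihood ratio at most [del]. *)
Lemma lik_close (D : nat) (e del : R) G1 G2 x :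
  norm2 (x - mu) <= M1 -> M1 <= M ->
  (forall al, (forall j, (al j <= D * 2)%N) -> `|moment G1 al - moment G2 al| <= e) ->
  expR (M1 ^+ 2 / (2 * a) - (M - M1) ^+ 2 / (2 * b)) <= del ->
  lik S mu G1 x <= lik S mu G2 x
   + (2 * (2^-1 ^+ D * expR (2 * log_lik_bound)) + expR log_lik_bound * e) + del.
Proof.
move=> xM MM close Hdel; have mN := measurable_near_set.
have iT G A : measurable A -> G.-integrable A
    (EFin \o (fun theta => lik_ratio S (x - mu) (theta - mu))).
  by move=> mA; exact: (integrable_lik_ratio a b).
have mNC : measurable (~` near_set) by exact: measurableC.
have split G : lik S mu G x =
   \int[G]_(theta in near_set) lik_ratio S (x - mu) (theta - mu)
   + \int[G]_(theta in ~` near_set) lik_ratio S (x - mu) (theta - mu).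
  rewrite /lik -[in LHS](setUv near_set) Rintegral_setU//.
    by rewrite setUv; exact: iT.
  exact/disj_setPCl.
have del0 : 0 <= del := le_trans (expR_ge0 _) Hdel.
have far : \int[G1]_(theta in ~` near_set) lik_ratio S (x - mu) (theta - mu) <= del.
  apply: (@le_trans _ _ (\int[G1]_(theta in ~` near_set) del)).
    apply: le_Rintegral => //; first exact: iT.
      by apply: (bounded_integrable _ _ `|del|).
    move=> theta /negP; rewrite -ltNge => Mt; apply: le_trans Hdel.
    rewrite ler_expR; set y := x - mu; set eta := theta - mu.
    have h1 : mahal S y / 2 <= M1 ^+ 2 / (2 * a).
      have -> : M1 ^+ 2 / (2 * a) = (M1 ^+ 2 / a) / 2.
        by field; rewrite gt_eqF.
      rewrite ler_pM2r// (le_trans (mahal_le a S a0 ST aS y))// ler_pM2r ?invr_gt0//.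
      by rewrite ler_sqr ?nnegrE ?norm2_ge0.
    have h2 : (M - M1) ^+ 2 / (2 * b) <= mahal S (y - eta) / 2.
      have -> : (M - M1) ^+ 2 / (2 * b) = ((M - M1) ^+ 2 / b) / 2.
        by field; rewrite gt_eqF.
      rewrite ler_pM2r// (le_trans _ (mahal_ge a b S a0 b0 ST aS Sb _))//.
      rewrite ler_pM2r ?invr_gt0// ler_sqr ?nnegrE ?norm2_ge0 ?subr_ge0//.
      have := norm2B y (y - eta); rewrite opprB addrCA subrr addr0 => tri.
      have : M < norm2 eta := Mt.
      have : norm2 y <= M1 := xM.
      lra.
    lra.
  rewrite Rintegral_cst//; apply: ler_piMr => //.
  by rewrite -lee_fin fineK ?fin_num_measure//; exact: probability_le1.
have far2 : 0 <= \int[G2]_(theta in ~` near_set) lik_ratio S (x - mu) (theta - mu).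
  by apply: Rintegral_ge0 => theta _; exact: expR_ge0.
have := integral_lik_ratio_close D e G1 G2 x xM close.
rewrite !split; lra.
Qed.
End likelihood.
End moments.

(** * Finite net and exponential tail bounds *)

Section finite_net.
Context {R : realType} {I : finType} {V : Type}.

(** Values are rounded down to a grid of step e. A cell that meets C is represented by one of its
    members in C and any other cell by v0, so that the whole net inherits C. *)
Lemma finite_net (F : V -> I -> R) (C : V -> Prop) (v0 : V) (e : R) :
  C v0 -> 0 < e -> (forall v i, `|F v i| <= 1) ->
  exists rep : {ffun I -> 'I_(Num.truncn (2 / e)).+1} -> V,
    (forall c, C (rep c)) /\
    forall v, C v -> exists c, forall i, `|F v i - F (rep c) i| <= e.
Proof.
move=> Cv0 e0 F1.
pose N := Num.truncn (2 / e).
pose cell v : {ffun I -> 'I_N.+1} :=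
  [ffun i => inord (Num.truncn ((F v i + 1) / e))].
have cellP c : exists v, C v /\ ((exists v, C v /\ cell v = c) -> cell v = c).
  have [[v [Cv vc]]|nv] := pselect (exists v, C v /\ cell v = c).
    by exists v.
  by exists v0.
have [rep repP] := choice cellP.
exists rep; split => [c|v Cv]; first by case: (repP c).
exists (cell v) => i.
have [_ /(_ (ex_intro _ v (conj Cv erefl)))] := repP (cell v).
move=> /(congr1 (fun f : {ffun I -> 'I_N.+1} => nat_of_ord (f i))).
have F0 u : 0 <= (F u i + 1) / e.
  rewrite divr_ge0// ?(ltW e0)//; have := F1 u i; rewrite ler_norml; lra.
(* This keeps [inord] away from its default value. *)
have le u : (Num.truncn ((F u i + 1) / e) <= N)%N.
  apply: le_truncn; rewrite ler_pM2r ?invr_gt0//.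
  have := F1 u i; rewrite ler_norml; lra.
rewrite !ffunE !inordK ?ltnS// => E.
have /andP[l1 u1] := truncn_itv (F0 v).
have /andP[l2 u2] := truncn_itv (F0 (rep (cell v))).
rewrite E in l2 u2.
set x := F v i; set y := F _ i.
have xE : x = (x + 1) / e * e - 1 by field; rewrite gt_eqF.
have yE : y = (y + 1) / e * e - 1 by field; rewrite gt_eqF.
rewrite xE yE opprB addrA subrK -mulrBl normrM (gtr0_norm e0).
rewrite -[leRHS]mul1r ler_pM2r// ler_norml.
by move: l1 u1 l2 u2; rewrite -/x -/y -natr1; lra.
Qed.
End finite_net.

Section markov.
Context {R : realType} {dT : measure_display} {T : measurableType dT}
  (P : probability T R).

Lemma markov_bound (Z : T -> R) (K v : R) : measurable_fun setT Z ->
  (forall w, 0 <= Z w) -> 0 < K -> 0 < v ->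
  (\int[P]_w (Z w)%:E <= K%:E)%E ->
  (P [set w | (K / v <= Z w)%R] <= v%:E)%E.
Proof.
move=> mZ Z0 K0 v0 EZ.
have Kv : 0 < K / v by rewrite divr_gt0.
set A := [set w | _].
have mA : measurable A.
  rewrite /A (_ : [set w | _] = Z @^-1` `[K / v, +oo[%classic).
    by rewrite -[X in measurable X]setTI; exact: mZ.
  by apply/seteqP; split => w /=; rewrite in_itv/= andbT.
have : ((K / v)%:E * P A <= K%:E)%E.
  apply: le_trans EZ.
  rewrite -[A in P A]setIT -(integral_indic P measurableT mA).
  rewrite -ge0_integralZl//; last 2 first.
  - exact/measurable_EFinP.
  - by rewrite lee_fin ltW.
  apply: ge0_le_integral => //.
  - by move=> w _; rewrite mule_ge0// lee_fin// ltW.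
  - by apply: measurable_funeM; exact/measurable_EFinP.
  - exact/measurable_EFinP.
  - move=> w _; rewrite -EFinM lee_fin indicE.
    by have [/set_mem|_] := boolP (w \in A); rewrite ?mulr1 ?mulr0.
have PA : P A \is a fin_num by exact: fin_num_measure.
rewrite -(fineK PA) -EFinM !lee_fin.
by rewrite -ler_pdivlMl// invf_div divfK// gt_eqF.
Qed.
End markov.

(** * Exponential bounds for outliers and over the net *)

Section event.
Context {R : realType} {d n : nat} (a b : R) (Sigma : 'I_n -> 'M[R]_d)
  (mu : 'rV[R]_d).
Hypotheses (n_gt0 : (0 < n)%N) (a0 : 0 < a) (b0 : 0 < b)
  (ST : forall i, (Sigma i)^T = Sigma i)
  (aS : forall i, loewner_le a%:M (Sigma i))
  (Sb : forall i, loewner_le (Sigma i) b%:M).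
Context {dT : measure_display} {T : measurableType dT} (P : probability T R)
  (X : 'I_n -> T -> 'rV[R]_d).
Hypotheses (indep : mutually_independent P X)
  (HX : forall i, has_normal_law P (X i) mu (Sigma i)).

Let mX i : measurable_fun setT (X i) := (HX i).1.

Lemma expectation_prod_le (g : 'I_n -> 'rV[R]_d -> R) (al : R) :
  (forall i, measurable_fun setT (g i)) -> (forall i x, 0 <= g i x) ->
  (forall i, (\int[P]_w (g i (X i w))%:E <= (expR al)%:E)%E) ->
  (\int[P]_w (\prod_i g i (X i w))%:E <= (expR (n%:R * al))%:E)%E.
Proof.
move=> mg g0 gle.
have ge0 i : (0 <= \int[P]_w (g i (X i w))%:E)%E.
  by apply: integral_ge0 => w _; rewrite lee_fin.
have fin i : (\int[P]_w (g i (X i w))%:E)%E \is a fin_num.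
  by rewrite ge0_fin_numE// (le_lt_trans (gle i))// ltry.
rewrite (expectation_prod P X mX indep g
  (fun i => fine (\int[P]_w (g i (X i w))%:E)%E))//; last first.
  by move=> i; rewrite fineK.
rewrite lee_fin expRM_natl.
apply: (@le_trans _ _ (\prod_(i < n) expR al)); last by rewrite prodr_const card_ord.
apply: ler_prod => i _; rewrite fine_ge0//=.
by rewrite -lee_fin fineK.
Qed.

Variables (M1 : R).

(* Since [3/8 * mahal >= 2 * decay * norm2 ^+ 2]. *)
Definition decay : R := 3 / (16 * b).

(** A penalty on outliers: a bound on its product over the sample controls both their
    log-likelihoods and the largest |X_i - mu|. *)
Definition large_weight (x : 'rV[R]_d) : R :=
  if norm2 (x - mu) <= M1 then 1 else expR (decay * norm2 (x - mu) ^+ 2).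

(** Near mu it dominates the root of any likelihood ratio exceeding that of G by at most (2/n)^2.
    Outliers get 1, their likelihood being charged to [large_weight]. *)
Definition sqrt_weight (i : 'I_n) (G : probability 'rV[R]_d R) (x : 'rV[R]_d) : R :=
  if norm2 (x - mu) <= M1 then Num.sqrt (lik (Sigma i) mu G x) + 2 / n%:R else 1.

Hypotheses (M10 : 0 <= M1) (tail : expR (- (decay * M1 ^+ 2)) * 2 ^+ d <= n%:R^-1).

(** Beyond M1, half of 2 [decay] |x - mu|^2 pays for the prefactor and the other half for
    [large_weight]; the mean is at most 1/n by [tail]. *)
Let tailf i x := expR (- (decay * M1 ^+ 2)) * expR (3 / 8 * mahal (Sigma i) (x - mu)).

Let decay_gt0 : 0 < decay.
Proof. by rewrite /decay divr_gt0// mulr_gt0. Qed.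

Let tailf_ge i x : M1 < norm2 (x - mu) ->
  expR (decay * norm2 (x - mu) ^+ 2) <= tailf i x.
Proof.
move=> xM; rewrite /tailf -expRD ler_expR.
have h1 := mahal_ge a b (Sigma i) a0 b0 (ST i) (aS i) (Sb i) (x - mu).
have h2 : decay * M1 ^+ 2 <= decay * norm2 (x - mu) ^+ 2.
  by rewrite ler_pM2l// ler_sqr ?nnegrE ?norm2_ge0// ltW.
have h3 : 2 * decay * norm2 (x - mu) ^+ 2 <= 3 / 8 * mahal (Sigma i) (x - mu).
  apply: le_trans (ler_wpM2l _ h1) => //.
  by rewrite le_eqVlt; apply/orP; left; apply/eqP; rewrite /decay; field; rewrite gt_eqF.
lra.
Qed.

Let measurable_tailf i : measurable_fun setT (fun w => tailf i (X i w)).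
Proof.
apply: measurable_funM => //; apply: (measurableT_comp (@measurable_expR R)) => //.
apply: measurable_funM => //; apply: measurable_mahal; exact: measurable_funB_rV.
Qed.

Let expectation_tailf i : (\int[P]_w (tailf i (X i w))%:E <= (n%:R^-1)%:E)%E.
Proof.
under eq_integral do rewrite /tailf EFinM.
rewrite ge0_integralZl//; last first.
  apply/measurable_EFinP; apply: (measurableT_comp (@measurable_expR R)) => //.
  apply: measurable_funM => //; apply: measurable_mahal; exact: measurable_funB_rV.
by rewrite (expectation_expR_mahal _ _ _ _ (HX i)) -EFinM lee_fin.
Qed.

Let measurable_norm_le : measurable_fun setT (fun x : 'rV[R]_d => norm2 (x - mu) <= M1).
Proof.
apply: measurable_fun_ler => //; apply: measurable_norm2; exact: measurable_funB_rV.
Qed.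

Let measurable_large_weight : measurable_fun setT large_weight.
Proof.
rewrite /large_weight.
apply: measurable_fun_ifT; [exact: measurable_norm_le|exact: measurable_cst|].
apply: (measurableT_comp (@measurable_expR R)) => //.
apply: measurable_funM => //; apply: measurable_funX.
by apply: measurable_norm2; exact: measurable_funB_rV.
Qed.

Let large_weight_ge0 x : 0 <= large_weight x.
Proof. by rewrite /large_weight; case: ifP => // _; exact: expR_ge0. Qed.

(** The mean is at most 1 + 1/n, so that the product over n independent observations has mean at
    most e. *)
Lemma expectation_large_weight i :
  (\int[P]_w (large_weight (X i w))%:E <= (expR n%:R^-1)%:E)%E.
Proof.
apply: (@le_trans _ _ (\int[P]_w (1 + (tailf i (X i w))%:E))%E).
  apply: ge0_le_integral => //.
  - by move=> w _; rewrite lee_fin.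
  - by apply/measurable_EFinP; apply: measurableT_comp.
  - by apply: emeasurable_funD => //; exact/measurable_EFinP.
  - move=> w _.
    suff : large_weight (X i w) <= 1 + tailf i (X i w) by rewrite -lee_fin EFinD.
    rewrite /large_weight; have [xM|xM] := leP (norm2 (X i w - mu)) M1.
      by rewrite lerDl mulr_ge0 ?expR_ge0.
    by rewrite (le_trans (tailf_ge i _ xM))// lerDr.
rewrite ge0_integralD//; last 2 first.
- by move=> w _; rewrite lee_fin mulr_ge0 ?expR_ge0.
- exact/measurable_EFinP.
rewrite integral_probability_cst.
apply: (@le_trans _ _ (1 + (n%:R^-1)%:E)%E); first by rewrite leeD2l.
by have := expR_ge1Dx (n%:R^-1 : R); rewrite -lee_fin EFinD.
Qed.

Let measurable_sqrt_lik i G :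
  measurable_fun setT (fun x => Num.sqrt (lik (Sigma i) mu G x)).
Proof.
apply: (measurableT_comp (continuous_measurable_fun (@sqrt_continuous R))) => //.
exact: (measurable_lik a b).
Qed.

Let measurable_sqrt_weight i G : measurable_fun setT (sqrt_weight i G).
Proof.
rewrite /sqrt_weight.
apply: measurable_fun_ifT; [exact: measurable_norm_le| |exact: measurable_cst].
by apply: measurable_funD.
Qed.

Let sqrt_weight_ge0 i G x : 0 <= sqrt_weight i G x.
Proof.
by rewrite /sqrt_weight; case: ifP => // _; rewrite addr_ge0 ?sqrtr_ge0 ?divr_ge0.
Qed.

(** Of the 3/n, two parts come from the cushion in [sqrt_weight] and one from the outliers; over n
    observations they cost the factor exp(3). *)
Lemma expectation_sqrt_weight i G (T0 : R) : T0 <= tau mu G ^+ 2 ->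
  (\int[P]_w (sqrt_weight i G (X i w))%:E
    <= (expR (3 / n%:R - @hell_const R d b * T0))%:E)%E.
Proof.
move=> HT.
have msq : measurable_fun setT (fun w => Num.sqrt (lik (Sigma i) mu G (X i w))).
  exact: (measurableT_comp (measurable_sqrt_lik i G)).
apply: (@le_trans _ _ (\int[P]_w ((Num.sqrt (lik (Sigma i) mu G (X i w)))%:E
    + ((2 / n%:R)%:E + (tailf i (X i w))%:E)))%E).
  apply: ge0_le_integral => //.
  - by move=> w _; rewrite lee_fin.
  - apply/measurable_EFinP; exact: (measurableT_comp (measurable_sqrt_weight i G)).
  - apply: emeasurable_funD; first exact/measurable_EFinP.
    by apply: emeasurable_funD => //; exact/measurable_EFinP.
  - move=> w _; rewrite -!EFinD lee_fin /sqrt_weight; have [xM|xM] := leP (norm2 (X i w - mu)) M1.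
      by rewrite lerD2l lerDl mulr_ge0 ?expR_ge0.
    have h := tailf_ge i _ xM.
    have : 1 <= expR (decay * norm2 (X i w - mu) ^+ 2).
      by rewrite -expR0 ler_expR mulr_ge0 ?sqr_ge0// ltW.
    have : 0 <= Num.sqrt (lik (Sigma i) mu G (X i w)) by exact: sqrtr_ge0.
    have : 0 <= 2 / n%:R :> R by rewrite divr_ge0.
    lra.
have n0 : 0 <= 2 / n%:R :> R by rewrite divr_ge0.
rewrite ge0_integralD//; last 3 first.
- exact/measurable_EFinP.
- by move=> w _; rewrite adde_ge0// lee_fin mulr_ge0 ?expR_ge0.
- by apply: emeasurable_funD => //; exact/measurable_EFinP.
rewrite ge0_integralD//; last 2 first.
- by move=> w _; rewrite lee_fin mulr_ge0 ?expR_ge0.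
- exact/measurable_EFinP.
rewrite integral_probability_cst.
apply: (@le_trans _ _ ((1 - @hell_const R d b * tau mu G ^+ 2)%:E
     + ((2 / n%:R)%:E + (n%:R^-1)%:E))%E).
  by rewrite leeD ?leeD2l// (expectation_sqrt_lik a b).
rewrite -!EFinD lee_fin; apply: le_trans (expR_ge1Dx _).
have h0 : 0 <= @hell_const R d b by rewrite /hell_const divr_ge0// sqr_ge0.
have := ler_wpM2l h0 HT.
have -> : 3 / n%:R = 2 / n%:R + n%:R^-1 :> R by rewrite -[X in _ + X]mul1r -mulrDl; congr (_ * _); ring.
lra.
Qed.

(** Markov's inequality is used once for the outlier penalties and once for the sum over the net,
    which dominates each of its nonnegative terms; this is the origin of the factor #|C|. *)
Lemma good_event (C : finType) (rep : C -> probability 'rV[R]_d R) (T0 v : R) :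
  (0 < #|C|)%N -> 0 < v -> (forall c, T0 <= tau mu (rep c) ^+ 2) ->
  exists F : set T, [/\ measurable F, ((1 - 2 * v)%:E <= P F)%E,
    (forall w, F w -> \prod_i large_weight (X i w) < expR 1 / v) &
    (forall w c, F w -> \prod_i sqrt_weight i (rep c) (X i w)
        < #|C|%:R * expR (3 - n%:R * (@hell_const R d b * T0)) / v)].
Proof.
move=> C0 v0 HT.
have nn : n%:R != 0 :> R by rewrite pnatr_eq0 -lt0n.
pose U w := \prod_i large_weight (X i w).
pose V w := \sum_c \prod_i sqrt_weight i (rep c) (X i w).
pose KV : R := #|C|%:R * expR (3 - n%:R * (@hell_const R d b * T0)).
have mU : measurable_fun setT U.
  by apply: measurable_prod => i _; apply: measurableT_comp.
have mVc c : measurable_fun setT (fun w => \prod_i sqrt_weight i (rep c) (X i w)).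
  by apply: measurable_prod => i _; exact: (measurableT_comp (measurable_sqrt_weight i _)).
have mV : measurable_fun setT V by apply: measurable_sum.
have U0 w : 0 <= U w by apply: prodr_ge0.
have Vc0 c w : 0 <= \prod_i sqrt_weight i (rep c) (X i w) by apply: prodr_ge0.
have V0 w : 0 <= V w by apply: sumr_ge0.
have EU : (\int[P]_w (U w)%:E <= (expR 1)%:E)%E.
  have := expectation_prod_le (fun=> large_weight) n%:R^-1 (fun=> measurable_large_weight)
    (fun=> large_weight_ge0) expectation_large_weight.
  by rewrite mulfV.
have EV : (\int[P]_w (V w)%:E <= KV%:E)%E.
  under eq_integral do rewrite /V -sumEFin.
  rewrite ge0_integral_sum//; last 2 first.
  - by move=> c; exact/measurable_EFinP.
  - by move=> c w _; rewrite lee_fin.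
  apply: (@le_trans _ _ (\sum_(c in C) (expR (3 - n%:R * (@hell_const R d b * T0)))%:E)%E).
    apply: lee_sum => c _.
    have := expectation_prod_le (fun i => sqrt_weight i (rep c))
      (3 / n%:R - @hell_const R d b * T0) (fun i => measurable_sqrt_weight i (rep c))
      (fun i => sqrt_weight_ge0 i (rep c))
      (fun i => expectation_sqrt_weight i (rep c) T0 (HT c)).
    by rewrite mulrBr mulrC divfK.
  by rewrite sumEFin sumr_const /KV -[X in (X%:E <= _)%E]mulr_natl.
have KV0 : 0 < KV by rewrite mulr_gt0 ?expR_gt0// ltr0n.
pose A1 := [set w | expR 1 / v <= U w]; pose A2 := [set w | KV / v <= V w].
have P1 : (P A1 <= v%:E)%E by apply: markov_bound => //; exact: expR_gt0.
have P2 : (P A2 <= v%:E)%E by apply: markov_bound.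
have mlev (Z : T -> R) (k : R) : measurable_fun setT Z -> measurable [set w | k <= Z w].
  move=> mZ; rewrite (_ : [set w | _] = Z @^-1` `[k, +oo[%classic).
    by rewrite -[X in measurable X]setTI; exact: mZ.
  by apply/seteqP; split => w /=; rewrite in_itv/= andbT.
have mA1 : measurable A1 := mlev _ _ mU.
have mA2 : measurable A2 := mlev _ _ mV.
exists (~` (A1 `|` A2)); split.
- by apply: measurableC; exact: measurableU.
- rewrite probability_setC; last exact: measurableU.
  rewrite EFinB leeB//.
  apply: le_trans (measureU2 _ mA1 mA2) _.
  by rewrite mulr_natl mulr2n EFinD; apply: leeD; [exact: P1|exact: P2].
- by move=> w /not_orP[/negP]; rewrite -ltNge.
- move=> w c /not_orP[_ /negP]; rewrite -ltNge; apply: le_lt_trans.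
  by rewrite /V (bigD1 c)//= lerDl sumr_ge0.
Qed.
End event.

(** * Deterministic comparison *)

Section wasserstein_dirac.
Context {R : realType} {d : nat} (mu : 'rV[R]_d).
Implicit Types (G : probability 'rV[R]_d R).

Lemma product_coupling G H : is_coupling G H (G \x H)%E.
Proof.
move=> A mA; split.
- rewrite (_ : fst @^-1` A = A `*` setT); last first.
    by apply/seteqP; split => [p|p []].
  transitivity (G A * H setT)%E; first exact: product_measure1E.
  by rewrite [H setT]probability_setT mule1.
- rewrite (_ : snd @^-1` A = setT `*` A); last first.
    by apply/seteqP; split => [p|p []].
  transitivity (G setT * H A)%E; first exact: product_measure1E.
  by rewrite [G setT]probability_setT mul1e.
Qed.

(** If 0 <= u <= K and 1 <= K then u <= K min(u, 1); here u is the squared distance to mu. *)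
Lemma integral_norm2_le_tau G (A : set 'rV[R]_d) (K : R) :
  1 <= K -> measurable A -> G A = 1%E ->
  (forall theta, A theta -> norm2 (theta - mu) ^+ 2 <= K) ->
  (\int[G]_theta (norm2 (theta - mu) ^+ 2)%:E <= (K * tau mu G)%:E)%E.
Proof.
move=> K1 mA GA AK; have K0 : 0 <= K := le_trans ler01 K1.
have mn : measurable_fun setT (fun theta : 'rV[R]_d => norm2 (theta - mu) ^+ 2).
  by apply: measurable_funX; apply: measurable_norm2; exact: measurable_funB_rV.
have mt : measurable_fun setT
    (fun theta : 'rV[R]_d => Num.min (norm2 (theta - mu) ^+ 2) 1).
  exact: measurable_minr.
have t0 theta : 0 <= Num.min (norm2 (theta - mu : 'rV[R]_d) ^+ 2) 1.
  by rewrite le_min sqr_ge0 ler01.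
rewrite EFinM EFin_tau -ge0_integralZl//; last 2 first.
- exact/measurable_EFinP.
- by move=> theta _; rewrite lee_fin.
apply: ae_ge0_le_integral => //.
- by move=> theta _; rewrite lee_fin sqr_ge0.
- exact/measurable_EFinP.
- by move=> theta _; rewrite mule_ge0 ?lee_fin.
- by apply: measurable_funeM; exact/measurable_EFinP.
exists (~` A); split.
- exact: measurableC.
- by have := probability_setC G mA; rewrite GA subee.
apply: subsetC => theta Ath _; rewrite -EFinM lee_fin.
have h := AK _ Ath; rewrite minEle; case: ifP => _.
  by rewrite ler_peMl ?sqr_ge0.
by rewrite mulr1.
Qed.

(** Any coupling bounds the infimum from above, and the product one will do. Fourth powers appear
    because tau is controlled through its square. *)
Lemma W2_dirac_le G (A : set 'rV[R]_d) (K B : R) :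
  1 <= K -> measurable A -> G A = 1%E ->
  (forall theta, A theta -> norm2 (theta - mu) ^+ 2 <= K) ->
  0 <= B -> K ^+ 2 * tau mu G ^+ 2 <= B ^+ 4 ->
  (W2 G \d_mu <= B%:E)%E.
Proof.
move=> K1 mA GA AK B0 KB; have K0 : 0 <= K := le_trans ler01 K1.
have KtB : K * tau mu G <= B ^+ 2.
  rewrite -ler_sqr ?nnegrE ?sqr_ge0 ?mulr_ge0 ?tau_ge0//.
  by rewrite exprMn -exprM.
have -> : B%:E = sqrte (B ^+ 2)%:E by rewrite /sqrte sqrtr_sqr ger0_norm.
rewrite /W2 lee_sqrt ?lee_fin ?sqr_ge0//.
have mN : measurable_fun setT
    (fun p : 'rV[R]_d * 'rV[R]_d => (norm2 (p.1 - p.2) ^+ 2)%:E).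
  apply/measurable_EFinP; apply: measurable_funX; apply: measurable_norm2.
  exact: measurable_funB_rV.
have cost : (\int[(G \x \d_mu)%E]_p (norm2 (p.1 - p.2) ^+ 2)%:E
    = \int[G]_theta (norm2 (theta - mu) ^+ 2)%:E)%E.
  rewrite fubini_tonelli1//; last by move=> p; rewrite lee_fin sqr_ge0.
  apply: eq_integral => theta _; rewrite /fubini_F.
  rewrite integral_dirac//; first by rewrite diracT mul1e.
  apply: (measurableT_comp mN); exact: measurable_pair1.
apply: (@le_trans _ _ (\int[(G \x \d_mu)%E]_p (norm2 (p.1 - p.2) ^+ 2)%:E)%E).
  by apply: ereal_inf_lbound; exists (G \x \d_mu)%E => //; exact: product_coupling.
rewrite cost; apply: le_trans (integral_norm2_le_tau _ _ _ K1 mA GA AK) _.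
by rewrite lee_fin.
Qed.
End wasserstein_dirac.

(** * Sample mean and sample radius *)

Section sample_geometry.
Context {R : realType} {d n : nat} (mu : 'rV[R]_d) (x : 'I_n -> 'rV[R]_d) (m : R).
Hypotheses (n_gt0 : (0 < n)%N) (xm : forall i, norm2 (x i - mu) <= m).

Let nn : n%:R != 0 :> R. Proof. by rewrite pnatr_eq0 -lt0n. Qed.

Lemma norm2_sum (I : Type) (s : seq I) (v : I -> 'rV[R]_d) :
  norm2 (\sum_(i <- s) v i) <= \sum_(i <- s) norm2 (v i).
Proof.
elim: s => [|i s IH]; first by rewrite !big_nil norm20.
by rewrite !big_cons (le_trans (norm2D _ _))// lerD2l.
Qed.

Lemma sample_mean_close : norm2 (sample_mean x - mu) <= m.
Proof.
have -> : sample_mean x - mu = n%:R^-1 *: \sum_(i < n) (x i - mu).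
  rewrite sumrB scalerBr /sample_mean; congr (_ - _).
  by rewrite sumr_const card_ord -[mu *+ n]scaler_nat scalerA mulVf// scale1r.
rewrite norm2Z ger0_norm ?invr_ge0// mulrC ler_pdivrMr ?ltr0n//.
apply: le_trans (norm2_sum _ _ _) _.
apply: (@le_trans _ _ (\sum_(i < n) m)); first by apply: ler_sum.
by rewrite sumr_const card_ord mulr_natr.
Qed.

Lemma sample_radius_le : sample_radius x <= 2 * m.
Proof.
have m0 : 0 <= m := le_trans (norm2_ge0 _) (xm (Ordinal n_gt0)).
rewrite /sample_radius; elim/big_ind : _ => //.
- by rewrite mulr_ge0.
- by move=> u v ul vl; rewrite ge_max ul vl.
move=> i _; rewrite -(subrK mu (x i)) -addrA.
apply: le_trans (norm2D _ _) _.
have := xm i; have := sample_mean_close; rewrite -norm2N opprB; lra.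
Qed.
End sample_geometry.

(** * From log-likelihoods to weights *)

Section likelihood_comparison.
Context {R : realType} {d n : nat} (a b : R) (Sigma : 'I_n -> 'M[R]_d)
  (mu : 'rV[R]_d).
Hypotheses (n_gt0 : (0 < n)%N) (a0 : 0 < a) (b0 : 0 < b)
  (ST : forall i, (Sigma i)^T = Sigma i)
  (aS : forall i, loewner_le a%:M (Sigma i))
  (Sb : forall i, loewner_le (Sigma i) b%:M).
Implicit Types (x : 'I_n -> 'rV[R]_d) (G : probability 'rV[R]_d R).

Lemma ln_prod (I : Type) (s : seq I) (f : I -> R) : (forall i, 0 < f i) ->
  ln (\prod_(i <- s) f i) = \sum_(i <- s) ln (f i).
Proof.
move=> f0; elim: s => [|i s IH]; first by rewrite !big_nil ln1.
by rewrite !big_cons lnM ?posrE ?IH// prodr_gt0.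
Qed.

Lemma lik_dirac i y : lik (Sigma i) mu \d_mu y = 1.
Proof.
apply: EFin_inj; rewrite (EFin_lik a b)// integral_dirac//.
  by rewrite diracT mul1e /lik_ratio subrr subr0 subrr expR0.
by apply/measurable_EFinP; exact: measurable_lik_ratio_theta.
Qed.

Lemma loglik_diff x G : (forall i y, 0 < gauss_pdf (Sigma i) y) ->
  loglik Sigma x \d_mu - loglik Sigma x G
  = - (n%:R^-1 * \sum_i ln (lik (Sigma i) mu G (x i))).
Proof.
move=> pdf0; rewrite /loglik -mulrBr -sumrB -mulrN -sumrN; congr (_ * _).
apply: eq_bigr => i _; rewrite !(gauss_mixE a b _ mu)// lik_dirac mul1r.
by rewrite lnM ?posrE// ?(lik_gt0 a b)// opprD addrCA subrr addr0.
Qed.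

(** Were the normalising root 0, its inverse would be 0 by convention and the density identically 0,
    against total mass 1. *)
Lemma normal_pdf_gt0 i (dT : measure_display) (T : measurableType dT)
    (P : probability T R) (X : T -> 'rV[R]_d) :
  has_normal_law P X mu (Sigma i) -> forall y, 0 < gauss_pdf (Sigma i) y.
Proof.
move=> HX y; rewrite gauss_pdfE divr_gt0// ?expR_gt0// lt_neqAle sqrtr_ge0 andbT.
apply/negP => /eqP Z0; have := HX.2 setT measurableT.
rewrite preimage_setT probability_setT integral0_eq => [/eqP|z _].
  by rewrite onee_eq0.
by rewrite gauss_pdfE -Z0 invr0 mulr0.
Qed.

Variables (M1 : R).

(** Its product with [decay] is 1 / (4 a), and |y - mu|^2 / (4 a) bounds half the log-likelihood
    ratio of any mixture at y. *)
Definition tail_power : R := 4 * b / (3 * a).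

Lemma sqrt_lik_le i G1 G2 y :
  (norm2 (y - mu) <= M1 ->
   lik (Sigma i) mu G1 y <= lik (Sigma i) mu G2 y + (2 / n%:R) ^+ 2) ->
  ln (lik (Sigma i) mu G1 y) / 2 <=
  ln (sqrt_weight Sigma mu M1 i G2 y)
   + tail_power * ln (large_weight b mu M1 y).
Proof.
move=> close.
have L1 : 0 < lik (Sigma i) mu G1 y by exact: (lik_gt0 a b).
have n0 : 0 < 2 / n%:R :> R by rewrite divr_gt0// ltr0n.
rewrite /sqrt_weight /large_weight.
have [yM|yM] := leP (norm2 (y - mu)) M1.
  rewrite ln1 mulr0 addr0.
  set s := Num.sqrt (lik _ _ G2 _).
  have s0 : 0 <= s := sqrtr_ge0 _.
  have sE : s ^+ 2 = lik (Sigma i) mu G2 y by rewrite sqr_sqrtr// lik_ge0.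
  rewrite ler_pdivrMr// mulr_natr -lnXn ?ltr_wpDl// ler_ln ?posrE//; last first.
    by rewrite exprn_gt0// ltr_wpDl.
  apply: le_trans (close yM) _; rewrite -sE; nra.
rewrite ln1 add0r expRK.
have h : ln (lik (Sigma i) mu G1 y) <= mahal (Sigma i) (y - mu) / 2.
  by rewrite -[leRHS]expRK ler_ln ?posrE ?expR_gt0// (lik_le a b).
have := mahal_le a (Sigma i) a0 (ST i) (aS i) (y - mu).
have -> : tail_power * (decay b * norm2 (y - mu) ^+ 2) = norm2 (y - mu) ^+ 2 / a / 4.
  by rewrite /tail_power /decay; field; rewrite !gt_eqF.
lra.
Qed.

Lemma sum_ln_lik_le x G1 G2 :
  (forall i, norm2 (x i - mu) <= M1 ->
   lik (Sigma i) mu G1 (x i) <= lik (Sigma i) mu G2 (x i) + (2 / n%:R) ^+ 2) ->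
  (\sum_i ln (lik (Sigma i) mu G1 (x i))) / 2 <=
  ln (\prod_i sqrt_weight Sigma mu M1 i G2 (x i))
   + tail_power * ln (\prod_i large_weight b mu M1 (x i)).
Proof.
move=> close; rewrite !ln_prod; last 2 first.
- by move=> i; rewrite /large_weight; case: ifP => // _; exact: expR_gt0.
- move=> i; rewrite /sqrt_weight; case: ifP => // _.
  by rewrite ltr_wpDl ?sqrtr_ge0// divr_gt0// ltr0n.
rewrite mulr_suml mulr_sumr -big_split/=; apply: ler_sum => i _.
exact: sqrt_lik_le (close i).
Qed.

(** All factors are at least 1, so each one is at most the product. *)
Lemma norm2_le_large_weight x i K : 0 <= M1 -> 
  \prod_j large_weight b mu M1 (x j) < expR K ->
  norm2 (x i - mu) ^+ 2 <= Num.max (M1 ^+ 2) (K / decay b).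
Proof.
move=> M10 HK; have [yM|yM] := leP (norm2 (x i - mu)) M1.
  by rewrite le_max ler_sqr ?nnegrE ?norm2_ge0// yM.
have dec0 : 0 < decay b by rewrite divr_gt0// mulr_gt0.
rewrite le_max; apply/orP; right; rewrite ler_pdivlMr// mulrC -ler_expR.
apply: le_trans (ltW HK); rewrite (bigD1 i)//=.
have -> : large_weight b mu M1 (x i) = expR (decay b * norm2 (x i - mu) ^+ 2).
  by rewrite /large_weight leNgt yM.
rewrite ler_peMr ?expR_ge0//; elim/big_ind : _ => //.
  by move=> u v u1 v1; rewrite mulr_ege1.
move=> j _; rewrite /large_weight; case: ifP => // _.
by rewrite -expR0 ler_expR mulr_ge0 ?sqr_ge0// ltW.
Qed.
End likelihood_comparison.

(** * Constants *)

Section constants.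
Context {R : realType} (d : nat) (a b c : R).
Hypotheses (a0 : 0 < a) (b0 : 0 < b) (c0 : 0 < c).

(** Makes the tail factor exp(- (1 + 2 d) l), with l = log n: exp(- l) is 1/n, and exp(- 2 d l)
    absorbs 2^d because 2 l >= 1. *)
Definition core_const : R := (1 + 2 * d%:R) / decay b.
(** The second root is the one for which the exponent of the far atoms in [near_far] is exactly - 2
    l, that is a contribution n^-2. *)
Definition near_const : R :=
  Num.sqrt core_const + Num.sqrt (b * core_const / a + 4 * b).
Definition log_lik_const : R :=
  d%:R ^+ 2 / a * (Num.sqrt core_const * near_const + near_const ^+ 2 / 2).
Definition entropy_const : R :=
  (8 * log_lik_const + 14) ^+ d * (6 + log_lik_const).
(** The summands pay, in order, for the terms in t^2 l, for the additive constants, for the entropy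
    of the net and for half the deficit c allowed to the estimator. *)
Definition threshold_const : R :=
  ((1 + tail_power a b) * 2 ^+ d + (3 + tail_power a b) * 2 ^+ d.+1
    + entropy_const + c / 2) / @hell_const R d b.
(** The factor 2 kappa + 1 comes from |theta - mu| <= kappa r + |Xbar - mu| with r at most twice the
    largest |X_i - mu|. The final 2 ensures that [radius_const] times t^2 l is at least 1. *)
Definition radius_const : R :=
  (2 * (b / a) + 1) ^+ 2 * (core_const + 3 / decay b) + 2.

Let dec0 : 0 < decay b. Proof. by apply: divr_gt0 => //; exact: mulr_gt0. Qed.

Lemma core_const_gt0 : 0 < core_const.
Proof. by apply: divr_gt0 => //; rewrite ltr_pwDl// mulr_ge0. Qed.

Lemma near_const_gt0 : 0 < near_const.
Proof. by rewrite ltr_pwDl ?sqrtr_ge0// sqrtr_gt0 core_const_gt0. Qed.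

Lemma log_lik_const_ge0 : 0 <= log_lik_const.
Proof.
apply: mulr_ge0; first by rewrite divr_ge0 ?sqr_ge0// ltW.
apply: addr_ge0; last by rewrite divr_ge0// sqr_ge0.
by apply: mulr_ge0; [exact: sqrtr_ge0|exact: ltW near_const_gt0].
Qed.

Lemma hell_const_gt0 : 0 < @hell_const R d b.
Proof.
by rewrite /hell_const divr_gt0// exprn_gt0// mulr_gt0 ?sep_const_gt0// exprn_gt0.
Qed.

Lemma tail_power_gt0 : 0 < tail_power a b.
Proof. by apply: divr_gt0 => //; exact: mulr_gt0. Qed.

Lemma entropy_const_gt0 : 0 < entropy_const.
Proof.
have h := log_lik_const_ge0.
rewrite /entropy_const; apply: mulr_gt0; last by rewrite ltr_wpDr.
by rewrite exprn_gt0// ltr_wpDl// mulr_ge0.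
Qed.

Lemma threshold_const_gt0 : 0 < threshold_const.
Proof.
rewrite divr_gt0 ?hell_const_gt0//.
have h1 := tail_power_gt0; have h2 := entropy_const_gt0.
have p1 : 0 < 2 ^+ d :> R by rewrite exprn_gt0.
have p2 : 0 < 2 ^+ d.+1 :> R by rewrite exprn_gt0.
by rewrite !addr_gt0// ?divr_gt0// mulr_gt0// addr_gt0.
Qed.

Lemma radius_const_ge2 : 2 <= radius_const.
Proof.
rewrite /radius_const lerDr; apply: mulr_ge0; first exact: sqr_ge0.
by apply: addr_ge0; [exact: ltW core_const_gt0|rewrite divr_ge0// ltW].
Qed.

Variables (n : nat) (l : R).
Hypotheses (n_gt0 : (0 < n)%N) (l_ge : 2^-1 <= l) (nE : expR l = n%:R).

Let l0 : 0 < l. Proof. by apply: lt_le_trans l_ge; rewrite invr_gt0. Qed.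
Let l2 : 1 <= 2 * l. Proof. by rewrite -ler_pdivrMl// mulr1. Qed.
Let l0' : 0 <= l. Proof. exact: ltW. Qed.

Definition core_radius : R := Num.sqrt core_const * Num.sqrt l.
Definition near_radius : R := near_const * Num.sqrt l.

Lemma core_radius_sqr : core_radius ^+ 2 = core_const * l.
Proof. by rewrite exprMn !sqr_sqrtr// ltW// core_const_gt0. Qed.

Lemma core_radius_ge0 : 0 <= core_radius.
Proof. by apply: mulr_ge0; exact: sqrtr_ge0. Qed.

Lemma near_radius_gt0 : 0 < near_radius.
Proof. by apply: mulr_gt0; [exact: near_const_gt0|rewrite sqrtr_gt0]. Qed.

Lemma core_le_near : core_radius <= near_radius.
Proof. by rewrite ler_wpM2r ?sqrtr_ge0// lerDl sqrtr_ge0. Qed.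

Lemma log_lik_boundE :
  @log_lik_bound R d near_radius a core_radius = log_lik_const * l.
Proof.
rewrite /log_lik_bound /near_radius /core_radius /log_lik_const.
move: (Num.sqrt l) (sqr_sqrtr l0') => s <-.
by field; rewrite gt_eqF.
Qed.

Lemma core_tail : expR (- (decay b * core_radius ^+ 2)) * 2 ^+ d <= n%:R^-1.
Proof.
rewrite core_radius_sqr -nE -expRN.
have -> : decay b * (core_const * l) = l + d%:R * (2 * l).
  by rewrite /core_const; field; rewrite gt_eqF.
have two : 2 <= expR 1 :> R by have := expR_ge1Dx (1 : R).
have : 2 ^+ d <= expR d%:R :> R.
  by rewrite -[d%:R]mulr1 expRM_natl lerXn2r ?nnegrE ?expR_ge0.
move=> /(ler_wpM2l (expR_ge0 (- (l + d%:R * (2 * l))))) /le_trans; apply.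
rewrite -expRD ler_expR opprD -addrA gerDl.
have : d%:R * 1 <= d%:R * (2 * l).
  by apply: ler_wpM2l => //; exact: l2.
lra.
Qed.

Lemma near_far : expR (core_radius ^+ 2 / (2 * a)
   - (near_radius - core_radius) ^+ 2 / (2 * b)) <= expR (- (2 * l)).
Proof.
have -> : near_radius - core_radius
    = Num.sqrt (b * core_const / a + 4 * b) * Num.sqrt l.
  by rewrite /near_radius /core_radius /near_const; ring.
rewrite core_radius_sqr exprMn !sqr_sqrtr//; last first.
  apply: addr_ge0; last by rewrite mulr_ge0// ltW.
  by rewrite divr_ge0 ?(ltW a0)// mulr_ge0 ?(ltW b0)// ltW// core_const_gt0.
rewrite ler_expR le_eqVlt; apply/orP; left; apply/eqP.
by field; rewrite !gt_eqF.
Qed.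

(** As 1/2 <= exp(-1/2), this degree D gives 2^-D <= exp(- (2 [log_lik_const] + 2) l), which beats
    the factor exp(2 [log_lik_const] l) of the Taylor error and leaves n^-2. *)
Definition degree : nat := (Num.truncn ((4 * log_lik_const + 4) * l)).+1.
Definition mesh : R := expR (- (2 * l) - log_lik_const * l).

Let deg_ge0 : 0 <= (4 * log_lik_const + 4) * l.
Proof. by rewrite mulr_ge0// addr_ge0// mulr_ge0// log_lik_const_ge0. Qed.

Lemma degree_error :
  2^-1 ^+ degree * expR (2 * (log_lik_const * l)) <= expR (- (2 * l)).
Proof.
have half : 2^-1 <= expR (- 2^-1) :> R.
  by apply: le_trans (expR_ge1Dx _); lra.
have : 2^-1 ^+ degree <= expR (degree%:R * - 2^-1) :> R.
  by rewrite expRM_natl lerXn2r ?nnegrE ?expR_ge0.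
move=> /(ler_wpM2r (expR_ge0 (2 * (log_lik_const * l)))) /le_trans; apply.
rewrite -expRD ler_expR.
have /andP[_] := truncn_itv deg_ge0; rewrite -/degree; lra.
Qed.

(** Four errors n^-2: the Taylor error twice, the moments and the far atoms. Their sum is the reason
    for the 2 in (2/n)^2. *)
Lemma net_error :
  2 * (2^-1 ^+ degree * expR (2 * (log_lik_const * l)))
   + expR (log_lik_const * l) * mesh + expR (- (2 * l)) <= (2 / n%:R) ^+ 2.
Proof.
have h := degree_error.
have -> : expR (log_lik_const * l) * mesh = expR (- (2 * l)).
  by rewrite /mesh -expRD; congr expR; ring.
have -> : (2 / n%:R) ^+ 2 = 4 * expR (- (2 * l)).
  rewrite -nE expRN expRM_natl; field.
  by rewrite gt_eqF// expR_gt0.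
lra.
Qed.

(** There are O(l^d) multi-indices and the logarithm of the number of grid values is O(l), hence the
    power d + 1. The additive constants are absorbed by 2 l >= 1. *)
Lemma net_card (N := Num.truncn (2 / mesh)) :
  #|{ffun {ffun 'I_d -> 'I_(degree * 2).+1} -> 'I_N.+1}|%:R
   <= expR (entropy_const * l ^+ d.+1).
Proof.
have mesh0 : 0 < mesh := expR_gt0 _.
have A30 := log_lik_const_ge0.
rewrite !card_ffun !card_ord natrX.
have hN : N.+1%:R <= expR ((6 + log_lik_const) * l).
  have h : 3 / mesh <= expR ((6 + log_lik_const) * l).
    have three : 3 <= expR 2 :> R by apply: le_trans (expR_ge1Dx _); lra.
    rewrite /mesh -expRN.
    apply: (@le_trans _ _ (expR 2 * expR (- (- (2 * l) - log_lik_const * l)))).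
      by rewrite ler_wpM2r ?expR_ge0.
    rewrite -expRD ler_expR; have := l2; lra.
  apply: le_trans h; rewrite -natr1.
  have /andP[h _] := @truncn_itv R (2 / mesh) (divr_ge0 (ler0n _ 2) (ltW mesh0)).
  have -> : 3 / mesh = 2 / mesh + mesh^-1 by rewrite -[X in _ + X]mul1r -mulrDl; congr (_ * _); ring.
  apply: lerD; first exact: h.
  rewrite -[leLHS]invr1 lef_pV2 ?posrE// /mesh -[leRHS]expR0 ler_expR.
  have := mulr_ge0 A30 l0'; have := l2; lra.
have hK : ((degree * 2).+1 ^ d)%:R <= ((8 * log_lik_const + 14) * l) ^+ d.
  rewrite natrX lerXn2r ?nnegrE ?ler0n//.
    by rewrite mulr_ge0// addr_ge0// mulr_ge0.
  rewrite -natr1 natrM /degree -[in leLHS]natr1.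
  have /andP[h _] := truncn_itv deg_ge0.
  set T := (Num.truncn _)%:R in h *; have := l2; nra.
apply: (@le_trans _ _ (expR ((6 + log_lik_const) * l) ^+ ((degree * 2).+1 ^ d))).
  by rewrite lerXn2r ?nnegrE ?ler0n ?expR_ge0.
rewrite -expRM_natl ler_expR.
apply: (@le_trans _ _ (((8 * log_lik_const + 14) * l) ^+ d * ((6 + log_lik_const) * l))).
  by rewrite ler_wpM2r// mulr_ge0// addr_ge0.
by rewrite le_eqVlt; apply/orP; left; apply/eqP; rewrite /entropy_const exprMn exprSr; ring.
Qed.

(** From 2 l >= 1 follow l <= 2^d l^(d+1) and 1 <= 2^(d+1) l^(d+1), which lift every term to a
    multiple of t^2 l^(d+1). The right-hand side is half the allowed log-likelihood deficit, because
    square roots are compared. *)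
Lemma threshold_wins (t : R) : 1 <= t ->
  entropy_const * l ^+ d.+1 + 3
   - @hell_const R d b * (threshold_const * t ^+ 2 * l ^+ d.+1)
   + t ^+ 2 * l + tail_power a b * (1 + t ^+ 2 * l)
  <= - (c * l ^+ d.+1) / 2.
Proof.
move=> t1; set h := @hell_const R d b; set r := tail_power a b.
have h0 : 0 < h := hell_const_gt0; have r0 : 0 < r := tail_power_gt0.
set E := entropy_const; have E0 : 0 < E := entropy_const_gt0.
have -> : h * (threshold_const * t ^+ 2 * l ^+ d.+1) =
   ((1 + r) * 2 ^+ d + (3 + r) * 2 ^+ d.+1 + E + c / 2) * (t ^+ 2 * l ^+ d.+1).
  by rewrite /threshold_const -/h -/r -/E; field; rewrite gt_eqF.
set L := l ^+ d.+1; set T := t ^+ 2; set p := 2 ^+ d.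
have T1 : 1 <= T by rewrite /T exprn_ege1.
have L0 : 0 < L by rewrite exprn_gt0.
have lL : l <= p * L.
  have : 1 <= (2 * l) ^+ d by rewrite exprn_ege1.
  rewrite exprMn => /(ler_wpM2r l0'); rewrite mul1r -/p.
  by rewrite /L exprSr mulrA.
have oneL : 1 <= 2 ^+ d.+1 * L.
  rewrite exprS -mulrA; apply: (le_trans l2).
  by rewrite ler_pM2l.
have LT : L <= T * L by rewrite ler_peMl// ltW.
set q := 2 ^+ d.+1 in oneL *.
have q0 : 0 < q by rewrite exprn_gt0.
have hT0 : 0 <= T by rewrite (le_trans ler01).
have i1 : T * l <= p * (T * L).
  by have := ler_wpM2l hT0 lL; rewrite mulrCA.
have i2 : 1 <= q * (T * L).
  by apply: (le_trans oneL); rewrite ler_pM2l.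
have j1 : (1 + r) * (T * l) <= (1 + r) * (p * (T * L)) by rewrite ler_pM2l// addr_gt0.
have j2 : (3 + r) * 1 <= (3 + r) * (q * (T * L)) by rewrite ler_pM2l// addr_gt0.
have j3 : E * L <= E * (T * L) by rewrite ler_pM2l.
have j4 : c / 2 * L <= c / 2 * (T * L) by rewrite ler_pM2l// divr_gt0.
lra.
Qed.
End constants.

(** * Conclusion *)

Lemma ln_nat_ge_half (R : realType) (n : nat) :
  (1 < n)%N -> 2^-1 <= ln (n%:R : R).
Proof.
move=> n1; rewrite -[leLHS]expRK ler_ln ?posrE ?expR_gt0 ?ltr0n ?(ltnW n1)//.
apply: (@le_trans _ _ 2); last by rewrite ler_nat.
have h := expR_ge1Dx (- 2^-1 : R).
have : expR 2^-1 * expR (- 2^-1) = 1 :> R by rewrite -expRD subrr expR0.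
have := expR_gt0 (2^-1 : R); nra.
Qed.

Lemma powR_exp4 (R : realType) (x r : R) (k : nat) :
  0 <= x -> r * 4 = k%:R -> (x `^ r) ^+ 4 = x ^+ k.
Proof. by move=> x0 rk; rewrite -powR_mulrn ?powR_ge0// -powRrM rk powR_mulrn. Qed.

Section uniform_bound.
Context {R : realType} {d n : nat} (a b c : R) (Sigma : 'I_n -> 'M[R]_d)
  (mu : 'rV[R]_d).
Hypotheses (n_gt1 : (1 < n)%N) (a0 : 0 < a) (b0 : 0 < b) (c0 : 0 < c)
  (ST : forall i, (Sigma i)^T = Sigma i)
  (aS : forall i, loewner_le a%:M (Sigma i))
  (Sb : forall i, loewner_le (Sigma i) b%:M).
Context {dT : measure_display} {T : measurableType dT} (P : probability T R)
  (X : 'I_n -> T -> 'rV[R]_d).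
Hypotheses (indep : mutually_independent P X)
  (HX : forall i, has_normal_law P (X i) mu (Sigma i)).

Let l : R := ln n%:R.
Let l_ge : 2^-1 <= l. Proof. exact: ln_nat_ge_half. Qed.
Let n0 : (0 < n)%N. Proof. exact: ltnW. Qed.
Let nE : expR l = n%:R. Proof. by rewrite lnK// posrE ltr0n. Qed.
Let nn : n%:R != 0 :> R. Proof. by rewrite pnatr_eq0 -lt0n. Qed.
Let M1 := core_radius d b l.
Let M := near_radius d a b l.

Lemma uniform_tau_bound (t : R) : 1 <= t ->
  exists F : set T, [/\ measurable F, ((1 - 2 * expR (- (t ^+ 2 * l)))%:E <= P F)%E,
    (forall w, F w ->
       \prod_i large_weight b mu M1 (X i w) < expR (1 + t ^+ 2 * l)) &
    (forall w G, F w ->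
       - (c * l ^+ d.+1) <= \sum_i ln (lik (Sigma i) mu G (X i w)) ->
       tau mu G ^+ 2 <= threshold_const d a b c * t ^+ 2 * l ^+ d.+1 / n%:R)].
Proof.
move=> t1; set s := t ^+ 2 * l; set T0 := _ / n%:R.
have v0 : 0 < expR (- s) :> R := expR_gt0 _.
have vE : expR 1 / expR (- s) = expR (1 + s) by rewrite -expRN opprK expRD.
have tail : expR (- (decay b * M1 ^+ 2)) * 2 ^+ d <= n%:R^-1.
  exact: core_tail.
have M10 : 0 <= M1 := core_radius_ge0 d b l.
(* The net needs a seed with tau^2 >= T0. If there is none, the bound on tau holds for every G, and
   a one-point net with threshold 0 still provides the outlier event. *)
have [[G0 HG0]|nG] := pselect (exists G : probability 'rV[R]_d R, T0 <= tau mu G ^+ 2); last first.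
  have unit1 : (0 < #|{: unit}|)%N by rewrite card_unit.
  have [F [mF PF HF _]] := good_event a b Sigma mu n0 a0 b0 ST aS Sb P X indep HX M1 M10
    tail unit (fun=> \d_mu) 0 (expR (- s)) unit1 v0 (fun=> sqr_ge0 _).
  exists F; split => //; first by move=> w Fw; rewrite -vE; exact: HF.
  move=> w G Fw _; rewrite leNgt; apply/negP => h; apply: nG.
  by exists G; exact: ltW.
have M0 : 0 < M by apply: near_radius_gt0.
pose D := degree d a b l; pose e := mesh d a b l.
pose I := {ffun 'I_d -> 'I_(D * 2).+1}.
have [rep [repC net]] := finite_net
  (fun (G : probability 'rV[R]_d R) (al : I) => moment mu M G (fun j => al j : nat))
  (fun G => T0 <= tau mu G ^+ 2) G0 e HG0 (expR_gt0 _)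
  (fun G al => moment_le1 mu M M0 G _).
have C0 : (0 < #|{ffun I -> 'I_(Num.truncn (2 / e)).+1}|)%N.
  by rewrite card_ffun card_ord expn_gt0.
have [F [mF PF HU HV]] := good_event a b Sigma mu n0 a0 b0 ST aS Sb P X indep HX M1 M10
    tail _ rep T0 (expR (- s)) C0 v0 repC.
exists F; split => //; first by move=> w Fw; rewrite -vE; exact: HU.
(* A G above the threshold lies in the cell of a net point whose product of weights is too small for
   the likelihood that G is assumed to have. *)
move=> w G Fw likG; rewrite leNgt; apply/negP => /ltW /net[cell close].
have cmp i : norm2 (X i w - mu) <= M1 ->
    lik (Sigma i) mu G (X i w) <= lik (Sigma i) mu (rep cell) (X i w) + (2 / n%:R) ^+ 2.
  move=> xM.
  have close' al : (forall j, (al j <= D * 2)%N) ->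
      `|moment mu M G al - moment mu M (rep cell) al| <= e.
    move=> alD; have := close [ffun j => inord (al j)].
    rewrite (_ : (fun j => _) = al)//; apply/funext => j.
    by rewrite ffunE inordK// ltnS.
  have := lik_close mu M M0 a b (Sigma i) M1 a0 b0 (ST i) (aS i) (Sb i) M10
    D e _ G (rep cell) (X i w) xM (core_le_near d a b l) close'
    (near_far d a b a0 b0 l l_ge).
  rewrite log_lik_boundE// => /le_trans; apply.
  by rewrite -addrA lerD2l; apply: net_error.
have := sum_ln_lik_le a b Sigma mu n0 a0 b0 ST aS Sb M1 (X ^~ w) G (rep cell) cmp.
have Upos : 0 < \prod_i large_weight b mu M1 (X i w).
  apply: prodr_gt0 => i _; rewrite /large_weight.
  by case: ifP => // _; exact: expR_gt0.
have Vpos : 0 < \prod_i sqrt_weight Sigma mu M1 i (rep cell) (X i w).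
  apply: prodr_gt0 => i _; rewrite /sqrt_weight; case: ifP => // _.
  by rewrite ltr_wpDl ?sqrtr_ge0// divr_gt0// ltr0n.
have ln_U : ln (\prod_i large_weight b mu M1 (X i w)) <= 1 + s.
  rewrite -[leRHS]expRK ler_ln ?posrE ?expR_gt0//.
  by rewrite -vE; exact/ltW/HU.
have ln_V : ln (\prod_i sqrt_weight Sigma mu M1 i (rep cell) (X i w)) <
    entropy_const d a b * l ^+ d.+1
     + (3 - n%:R * (@hell_const R d b * T0)) + s.
  rewrite -[ltRHS]expRK ltr_ln ?posrE ?expR_gt0//.
  apply: lt_le_trans (HV w cell Fw) _.
  rewrite -expRN opprK [leRHS]expRD.
  rewrite ler_pM2r ?expR_gt0// [leRHS]expRD ler_pM2r ?expR_gt0//.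
  exact: net_card.
have nT0 : n%:R * (@hell_const R d b * T0)
    = @hell_const R d b * (threshold_const d a b c * t ^+ 2 * l ^+ d.+1).
  by rewrite /T0; field.
rewrite nT0 in ln_V.
have r0 : 0 < tail_power a b by apply: tail_power_gt0.
have := ler_wpM2l (ltW r0) ln_U.
have := threshold_wins d a b c a0 b0 c0 l l_ge t t1.
rewrite -/s; move: likG ln_V; lra.
Qed.
End uniform_bound.

Theorem theorem13 (R : realType) (d : nat) (d_gt0 : (0 < d)%N)
    (k_lo k_hi : R) (k_lo_gt0 : 0 < k_lo) (k_lo_hi : k_lo <= k_hi)
    (c : R) (c_gt0 : 0 < c) :
  exists2 C : R, 0 < C &
  forall (n : nat) (n_gt0 : (0 < n)%N)
    (Sigma : 'I_n -> 'M[R]_d)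
    (Sigma_sym : forall i, (Sigma i)^T = Sigma i)
    (Sigma_lo : forall i, loewner_le (k_lo%:M) (Sigma i))
    (Sigma_hi : forall i, loewner_le (Sigma i) (k_hi%:M))
    (mu : 'rV[R]_d)
    (dT : measure_display) (T : measurableType dT) (P : probability T R)
    (X : 'I_n -> T -> 'rV[R]_d)
    (X_indep : mutually_independent P X)
    (X_normal : forall i, has_normal_law P (X i) mu (Sigma i))
    (Ghat : ('I_n -> 'rV[R]_d) -> probability 'rV[R]_d R)
    (Ghat_supp : forall w : T, let x := fun i => X i w in
      Ghat x [set y | norm2 (y - sample_mean x)
                      <= k_hi / k_lo * sample_radius x] = 1%E)
    (Ghat_lik : forall w : T, let x := fun i => X i w in
      loglik Sigma x \d_mu - loglik Sigma x (Ghat x)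
        <= c * (ln n%:R ^+ d.+1 / n%:R)),
  forall t : R, 1 <= t ->
    with_prob_ge P (1 - 3 * n%:R `^ (- t ^+ 2))
      [set w | (W2 (Ghat (fun i => X i w)) \d_mu
                <= (C * t `^ (3 / 2) * ln n%:R `^ ((d%:R + 3) / 4)
                    / n%:R `^ (4^-1))%:E)%E].
Proof.
have k_hi_gt0 : 0 < k_hi := lt_le_trans k_lo_gt0 k_lo_hi.
set thr := threshold_const d k_lo k_hi c.
set rad := radius_const d k_lo k_hi.
have thr0 : 0 < thr by apply: threshold_const_gt0.
have rad2 : 2 <= rad by apply: radius_const_ge2.
have C0 : 0 <= rad ^+ 2 * thr by rewrite mulr_ge0 ?sqr_ge0// ltW.
(* The 1 gives C >= 1, so that C^4 >= C >= rad^2 thr and no fourth root is taken. *)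
exists (1 + rad ^+ 2 * thr); first by rewrite ltr_pwDl.
set C := 1 + _.
move=> n n_gt0 Sigma ST aS Sb mu dT T P X indep HX Ghat supp likh t t1.
(* For n = 1 the lower bound on log n fails, but the required probability is 1 - 3 < 0. *)
have [n1|n1] := leqP n 1.
  exists set0; split => //; rewrite measure0 lee_fin.
  have -> : n = 1%N by apply/eqP; rewrite eqn_leq n1.
  by rewrite powR1 mulr1; lra.
set l : R := ln n%:R.
have l_ge : 2^-1 <= l by apply: ln_nat_ge_half.
have l0 : 0 < l by apply: lt_le_trans l_ge; rewrite invr_gt0.
have nn : n%:R != 0 :> R by rewrite pnatr_eq0 -lt0n.
have [F [mF PF HU Htau]] := uniform_tau_bound k_lo k_hi c Sigma mu n1 k_lo_gt0 k_hi_gt0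
  c_gt0 ST aS Sb P X indep HX t t1.
have vE : n%:R `^ (- t ^+ 2) = expR (- (t ^+ 2 * l)).
  by rewrite /powR (negbTE nn) mulNr.
exists F; split => //; last first.
  apply: le_trans PF; rewrite lee_fin vE.
  have := expR_gt0 (- (t ^+ 2 * l)); rewrite /l; lra.
move=> w Fw /=.
set x := fun i => X i w; set G := Ghat x.
have pdf0 i y : 0 < gauss_pdf (Sigma i) y by apply: normal_pdf_gt0 (HX i) y.
have likG : - (c * l ^+ d.+1) <= \sum_i ln (lik (Sigma i) mu G (X i w)).
  have := likh w; rewrite /= (loglik_diff k_lo k_hi)// -/l.
  rewrite mulrA -mulrN [leRHS]mulrC ler_pM2l ?invr_gt0 ?ltr0n//.
  by rewrite lerNl.
have tauG := Htau w G Fw likG.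
have m2 i : norm2 (x i - mu) ^+ 2 <=
    Num.max (core_radius d k_hi l ^+ 2) ((1 + t ^+ 2 * l) / decay k_hi).
  by apply: norm2_le_large_weight => //; [exact: core_radius_ge0|exact: HU].
have dec0 : 0 < decay k_hi by rewrite divr_gt0// mulr_gt0.
have tt : 1 <= t ^+ 2 by rewrite exprn_ege1.
have t0 : 0 <= t := le_trans ler01 t1.
(* The 3 comes from 1 + t^2 l <= 3 t^2 l, as 2 l >= 1. *)
set B2 := (core_const d k_hi + 3 / decay k_hi) * (t ^+ 2 * l).
have tl : l <= t ^+ 2 * l by rewrite ler_peMl// ltW.
have tl0 : 0 <= t ^+ 2 * l := le_trans (ltW l0) tl.
have A0 : 0 < core_const d k_hi by apply: core_const_gt0.
have l2 : 1 <= 2 * l by rewrite -ler_pdivrMl// mulr1.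
have m3 : Num.max (core_radius d k_hi l ^+ 2) ((1 + t ^+ 2 * l) / decay k_hi) <= B2.
  rewrite /B2 core_radius_sqr// ge_max mulrDl; apply/andP; split.
    apply: (@le_trans _ _ (core_const d k_hi * (t ^+ 2 * l))).
      by rewrite ler_pM2l.
    by rewrite lerDl; apply: mulr_ge0 => //; rewrite divr_ge0// ltW.
  apply: (@le_trans _ _ (3 / decay k_hi * (t ^+ 2 * l))).
    by rewrite [leRHS]mulrAC ler_pM2r ?invr_gt0//; lra.
  by rewrite lerDr; apply: mulr_ge0 => //; exact: ltW.
have B20 : 0 <= B2 by apply: le_trans m3; rewrite le_max sqr_ge0.
have xm i : norm2 (x i - mu) <= Num.sqrt B2.
  by rewrite -ler_sqr ?nnegrE ?norm2_ge0 ?sqrtr_ge0// [leRHS]sqr_sqrtr// (le_trans (m2 i)).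
have mean_close := sample_mean_close mu x _ n_gt0 xm.
have rad_le := sample_radius_le mu x _ n_gt0 xm.
pose A := [set y | norm2 (y - sample_mean x) <= k_hi / k_lo * sample_radius x].
have kk0 : 0 < k_hi / k_lo by rewrite divr_gt0.
apply: (W2_dirac_le mu G A (rad * (t ^+ 2 * l))).
- have := ler_pM (ler0n R 2) (ltW l0) rad2 tl; lra.
- rewrite /A (_ : [set y | _] = near_set (sample_mean x) (k_hi / k_lo * sample_radius x))//.
  exact: measurable_near_set.
- exact: supp.
- move=> theta; rewrite /A /= => Ath.
  have th : norm2 (theta - mu) <= (2 * (k_hi / k_lo) + 1) * Num.sqrt B2.
    rewrite -(subrK (sample_mean x) theta) -addrA.
    apply: le_trans (norm2D _ _) _.
    have := ler_wpM2l (ltW kk0) rad_le; lra.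
  apply: (@le_trans _ _ (((2 * (k_hi / k_lo) + 1) * Num.sqrt B2) ^+ 2)).
    by rewrite ler_sqr ?nnegrE ?norm2_ge0// (le_trans (norm2_ge0 _) th).
  rewrite exprMn sqr_sqrtr// /B2 [leLHS]mulrA ler_pM2r.
    by rewrite /rad /radius_const lerDl.
  by apply: lt_le_trans tl.
- rewrite !mulr_ge0 ?invr_ge0 ?powR_ge0//.
  by rewrite addr_ge0.
(* In the fourth power all real exponents become natural numbers: 6, d + 3 and 1. *)
- set B := _ / _ `^ _.
  have -> : B ^+ 4 = C ^+ 4 * (t ^+ 6 * l ^+ (d + 3) / n%:R).
    rewrite /B !exprMn exprVn.
    rewrite (powR_exp4 _ t (3 / 2) 6)//; last by field.
    rewrite (powR_exp4 _ l ((d%:R + 3) / 4) (d + 3))//; last 2 first.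
    - exact: ltW.
    - by rewrite natrD; field.
    rewrite (powR_exp4 _ n%:R 4^-1 1)//; last by rewrite mulVf.
    by rewrite expr1 !mulrA.
  apply: (@le_trans _ _ ((rad * (t ^+ 2 * l)) ^+ 2 * (thr * t ^+ 2 * l ^+ d.+1 / n%:R))).
    by rewrite ler_wpM2l ?sqr_ge0.
  have -> : (rad * (t ^+ 2 * l)) ^+ 2 * (thr * t ^+ 2 * l ^+ d.+1 / n%:R)
      = (rad ^+ 2 * thr) * (t ^+ 6 * l ^+ (d + 3) / n%:R).
    rewrite (exprS l d) (exprD l d 3); move: (l ^+ d) => L.
    by field.
  apply: ler_wpM2r.
    by rewrite divr_ge0// mulr_ge0 ?exprn_ge0// ltW.
  have C1 : 1 <= C by rewrite lerDl.
  apply: (@le_trans _ _ C); first by rewrite lerDr.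
  by rewrite exprS ler_peMr ?exprn_ege1// (le_trans ler01 C1).
Qed.
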